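(* Let $q$ be a prime power, $m\ge 2$ an integer not divisible by the characteristic of $\mathbb{F}_q$, and $f(x)\in\mathbb{F}_q[x]$ a polynomial with $\deg(f)\ge 2$, all of whose roots lie in $\mathbb{F}_q$, which is not a $d$-th power of an element of $\mathbb{F}_q(x)$ for any divisor $d>1$ of $m$. Let $\mathcal{X}: y^m=f(x)$, with function field $F=\mathbb{F}_q(\mathcal{X})=\mathbb{F}_q(x,y)$. Let $P_1,\dots,P_r$ be the (distinct) places of $\mathbb{F}_q(x)$ that are zeros or poles of $f(x)$, and $\lambda_k=\nu_{P_k}(f(x))$ for $1\le k\le r$. Let $n\le r$ be such that $P_1,\dots,P_n$ are totally ramified in $F/\mathbb{F}_q(x)$, let $Q_k$ be the unique place of $F$ over $P_k$ for $1\le k\le n$, and let $\mathbf{Q}=(Q_1,\dots,Q_n)$. For $1\le i\le m-1$ and $1\le k\le n$ put $$t_k(i)=(i\lambda_k)\bmod m,\qquad \beta(i)=\sum_{k=1}^{r}\left\lceil\frac{i\lambda_k}{m}\right\rceil-1 .$$ Assume $2\le n\le q$. Let $\Upsilon$ denote either $\Gamma$ or $\Lambda$, and let $\rho=0$ if $\Upsilon=\Gamma$ and $\rho=n-2$ if $\Upsilon=\Lambda$. Then $$\Upsilon(\mathbf{Q})=\left\{(mj_1+t_1(i),\dots,mj_n+t_n(i)) : 1\le i\le m-1,\ j_1,\dots,j_n\in\mathbb{N}_0,\ j_1+\cdots+j_n=\beta(i)+1-n+\rho\right\}.$$ In addition, $$|\Upsilon(\mathbf{Q})|=\sum_{i=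1}^{m-1}\binom{\beta(i)+\rho}{n-1}.$$
   Context: For integers $a,b$, $b\bmod a$ is the smallest non-negative integer congruent to $b$ modulo $a$; $\binom{a}{b}=0$ if $a<b$. $\mathbb{N}$ is the set of positive integers and $\mathbb{N}_0=\mathbb{N}\cup\{0\}$. $\nu_P$ is the discrete valuation at a place $P$. Let $F/\mathbb{F}_q$ be a function field and $\mathbf{Q}=(Q_1,\dots,Q_n)$ an $n$-tuple of distinct rational places. Let $R_{\mathbf{Q}}$ be the ring of functions in $F$ regular outside $\{Q_1,\dots,Q_n\}$. The generalized Weierstrass semigroup is $$\widehat{H}(\mathbf{Q})=\{(-\nu_{Q_1}(z),\dots,-\nu_{Q_n}(z))\in\mathbb{Z}^n : z\in R_{\mathbf{Q}}\setminus\{0\}\}.$$ Let $I=\{1,\dots,n\}$. For a nonempty $J\subsetneq I$ and $\alpha\in\mathbb{Z}^n$ let $$\nabla_J(\alpha)=\{\beta\in\widehat{H}(\mathbf{Q}) : \beta_j=\alpha_j \text{ for } j\in J,\ \beta_i<\alpha_i \text{ for } i\notin J\},\qquad \nabla(\alpha)=\bigcup_{i=1}^n\nabla_{\{i\}}(\alpha).$$ An element $\alpha\in\widehat{H}(\mathbf{Q})$ is maximal if $\nabla(\alpha)=\emptyset$. It is absolute maximal if it is maximal and $\nabla_J(\alpha)=\emptyset$ for every $J\subsetneq I$ with $|J|\ge 2$; it is relative maximal if it is maximal and $\nabla_J(\alpha)\ne\emptyset$ for every $J\subsetneq I$ with $|J|\ge2$. $\widehat{\Gamma}(\mathbf{Q})$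 and $\widehat{\Lambda}(\mathbf{Q})$ denote the sets of absolute maximal and relative maximal elements of $\widehat{H}(\mathbf{Q})$, respectively, and $$\Gamma(\mathbf{Q})=\widehat{\Gamma}(\mathbf{Q})\cap\mathbb{N}^n,\qquad \Lambda(\mathbf{Q})=\widehat{\Lambda}(\mathbf{Q})\cap\mathbb{N}^n.$$ *)

(* Defs.v *)
From HB Require Import structures.
From mathcomp Require Import all_boot all_order all_algebra all_field.
From mathcomp Require Import boolp classical_sets functions cardinality.

Set Implicit Arguments.
Unset Strict Implicit.
Unset Printing Implicit Defensive.

Import Order.TTheory GRing.Theory Num.Theory.

Local Open Scope classical_set_scope.
Local Open Scope ring_scope.

(* Places of a field extension F/k, where k is embedded in F by iota. As in
   Stichtenoth's "Algebraic Function Fields and Codes", a place is the maximal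
   ideal of a valuation ring of F/k. *)
Section Places.
Variables (k F : fieldType) (iota : {rmorphism k -> F}).
Implicit Types (O P : set F) (z t u : F).

Definition valuation_ring O : Prop :=
  [/\ subring_closed (mem O), range iota `<` O, O `<` [set: F]
    & forall z, O z \/ O z^-1].

Definition ring_units O : set F := [set u | [/\ u != 0, O u & O u^-1]].

Definition place P : Prop :=
  exists2 O, valuation_ring O & P = O `\` ring_units O.

(* The valuation ring O_P = {z | z^-1 is not in P}; 0 is listed separately
   because 0^-1 = 0 here. *)
Definition val_ring P : set F := [set z | z = 0 \/ ~ P z^-1].

Definition prime_element P t : Prop := P = [set t * w | w in val_ring P].

(* The discrete valuation: nu P (t ^ n * u) = n for t a prime element of P and
   u a unit of O_P. No such expression exists for z = 0, where the infinite
   value is replaced by the dummy 0; nu is only meant for z != 0. *)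
Definition nu P z : int :=
  xget 0 [set n : int | exists t u,
    [/\ prime_element P t, ring_units (val_ring P) u & z = t ^ n * u]].

End Places.

(* Base field E (with constants iota : k -> E) and finite extension F/E. *)
Section Ramification.
Variables (k E : fieldType) (iota : {rmorphism k -> E}) (F : fieldExtType E).

Definition const_ext : {rmorphism k -> F} := in_alg F \o iota.

Definition lies_over (P' : set F) (P : set E) : Prop :=
  [set z%:A | z in P] `<=` P'.

Definition ramification_index (P' : set F) (P : set E) (e : nat) : Prop :=
  forall z : E, z != 0 -> nu P' z%:A = e%:Z * nu P z.

Definition totally_ramified (P : set E) : Prop :=
  exists P' : set F,
    [/\ place const_ext P', lies_over P' P,
        forall P'', place const_ext P'' -> lies_over P'' P -> P'' = P'
      & ramification_index P' P (\dim {:F})].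

End Ramification.

Section WeierstrassSemigroup.
Variables (k F : fieldType) (iota : {rmorphism k -> F}).
Variables (n : nat) (Q : 'I_n -> set F).
Implicit Types (a b : {ffun 'I_n -> int}) (J : {set 'I_n}).

Definition regular_outside : set F :=
  [set z | forall P, place iota P -> (forall i, P <> Q i) -> val_ring P z].

Definition Hhat : set {ffun 'I_n -> int} :=
  [set a | exists z, [/\ regular_outside z, z != 0
                       & a = [ffun i => - nu (Q i) z]]].

Definition nablaJ J a : set {ffun 'I_n -> int} :=
  [set b | [/\ Hhat b, forall j, j \in J -> b j = a j
             & forall i, i \notin J -> b i < a i]].

Definition nabla a : set {ffun 'I_n -> int} :=
  \bigcup_(i in [set: 'I_n]) nablaJ [set i]%SET a.

Definition maximal a : Prop := Hhat a /\ nabla a = set0.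

Definition Gamma_hat : set {ffun 'I_n -> int} :=
  [set a | maximal a /\
     forall J, J \proper [set: 'I_n]%SET -> (2 <= #|J|)%N -> nablaJ J a = set0].

Definition Lambda_hat : set {ffun 'I_n -> int} :=
  [set a | maximal a /\
     forall J, J \proper [set: 'I_n]%SET -> (2 <= #|J|)%N -> nablaJ J a !=set0].

Definition positive_orthant : set {ffun 'I_n -> int} :=
  [set a | forall i, 0 < a i].

Definition Gamma := Gamma_hat `&` positive_orthant.
Definition Lambda := Lambda_hat `&` positive_orthant.

End WeierstrassSemigroup.

Definition ratfun_const (K : fieldType) : {rmorphism K -> {fraction {poly K}}} :=
  @tofrac {poly K} \o polyC.

(* t_k(i), for l = lambda_k. *)
Definition residue (m : nat) (l : int) (i : nat) : int :=
  ((i%:Z * l) %% m%:Z)%Z.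

Definition beta (m r : nat) (lambda : 'I_r -> int) (i : nat) : int :=
  (\sum_(k < r) Num.ceil ((i%:Z * lambda k)%:~R / m%:R : rat)) - 1.

(* Binomial coefficient with integer upper argument, 0 when a < b (so in
   particular when a < 0). *)
Definition binomz (a : int) (b : nat) : nat :=
  if a is Posz c then 'C(c, b) else 0.

(* Main.v *)
(* Let E = K(x) and d = [F : E]. At a totally ramified rational place, the powers
   of a uniformizer form a basis of F over E whose elements have valuations
   distinct modulo d. Comparing with y ^ m = f gives d = m and nu(f) prime to m,
   so that in z = sum_i a_i y^-i the terms also have distinct valuations modulo m
   at each Q_k, and -nu(z) is the maximum of the pole orders of the terms.

   If z is regular outside Q, so is each term: extend a place of E to a field
   containing F and the m-th roots of unity, and average over the conjugates
   y -> zeta ^ j y. Hence the semigroup consists of the maxima of tuples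
   m j + t(i), where a_i ranges over the functions of E with prescribed zeros and
   poles; since principal divisors have degree 0, and since n <= q leaves a
   rational place free to absorb zeros, such a tuple occurs if and only if
   j_1 + ... + j_n >= N(i), with N(0) = 0 and N(i) = beta(i) + 1 - n otherwise.

   Maximality forces a single class i, and lowering the coordinates outside J
   shows that nabla_J is nonempty exactly when the sum of the j_k is at least
   N(i) + n - |J|: absolute maximality means that the sum is N(i), relative
   maximality that it is N(i) + n - 2. *)

Require Import Defs.
From HB Require Import structures.
From mathcomp Require Import all_boot all_order all_algebra all_field cyclic.
From mathcomp Require Import boolp classical_sets functions cardinality.
From mathcomp Require Import zify ring.

Set Implicit Arguments.
Unset Strict Implicit.
Unset Printing Implicit Defensive.

Import Order.TTheory GRing.Theory Num.Theory.

Local Open Scope classical_set_scope.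
Local Open Scope ring_scope.

(** * Subrings of a field and Chevalley's extension theorem *)

(** A place is only the maximal ideal of some valuation ring, not known to be discrete, and [nu] is
    0 by default where no prime element exists. Orders are therefore computed only at the rational
    places of [E] and at the totally ramified places above them, relative to a fixed uniformizer. At
    other places only membership is used: [a y^-i] is tested through its m-th power [a^m f^-i],
    which lies in [E], since a valuation ring contains the roots of its elements. Accordingly the
    degree formula is needed only as an inequality over rational places. The places of [E] and the
    extensions of valuation rings both come from Chevalley's theorem.

    Negative powers of [y] are chosen because [a y^-i] has pole order [- m nu(a) + i lambda_k] at
    [Q_k]. Division of [i lambda_k] by [m] gives [t_k(i)] and [j_k = floor(i lambda_k / m) - nu(a)].
    The degree inequality then bounds the sum of the [j_k] below by floors at the chosen places plus
    ceilings at the others. For [0 < i < m] each floor is its ceiling minus 1, whence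
    [beta(i) + 1 - n]; for [i = 0] everything vanishes. *)

Section Subrings.
Variable L : fieldType.
Implicit Types (O A B S : set L) (z w : L).

Definition is_subring O : Prop :=
  [/\ O 1, forall x y, O x -> O y -> O (x - y)
    & forall x y, O x -> O y -> O (x * y)].

Lemma is_subringP O : subring_closed (mem O) <-> is_subring O.
Proof.
split=> [[O1 OB OM]|[O1 OB OM]].
  split; first by move: O1; rewrite inE.
    by move=> x y Ox Oy; have := OB x y; rewrite !inE; apply.
  by move=> x y Ox Oy; have := OM x y; rewrite !inE; apply.
split; first by rewrite inE.
  by move=> x y; rewrite !inE; apply: OB.
by move=> x y; rewrite !inE; apply: OM.
Qed.

Variable O : set L.
Hypothesis Oring : is_subring O.

Lemma subring1 : O 1. Proof. by case: Oring. Qed.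

Lemma subringB x y : O x -> O y -> O (x - y). Proof. by case: Oring => ? + _; apply. Qed.

Lemma subringM x y : O x -> O y -> O (x * y). Proof. by case: Oring => ? _; apply. Qed.

Lemma subring0 : O 0. Proof. by rewrite -(subrr 1); apply: subringB; apply: subring1. Qed.

Lemma subringN x : O x -> O (- x).
Proof. by rewrite -sub0r => Ox; apply: subringB => //; apply: subring0. Qed.

Lemma subringD x y : O x -> O y -> O (x + y).
Proof. by move=> Ox Oy; rewrite -[y]opprK; apply/subringB/subringN. Qed.

Lemma subringX x k : O x -> O (x ^+ k).
Proof.
by move=> Ox; elim: k => [|k IH]; rewrite ?expr0 ?exprS;
   [apply: subring1 | apply: subringM].
Qed.

Lemma subring_sum (I : Type) (r : seq I) (P : pred I) (F : I -> L) :
  (forall i, P i -> O (F i)) -> O (\sum_(i <- r | P i) F i).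
Proof. by move=> OF; apply: big_ind => //; [exact: subring0 | exact: subringD]. Qed.

Lemma subring_horner (p : {poly L}) w :
  (forall i, O p`_i) -> O w -> O p.[w].
Proof.
move=> Op Ow; rewrite horner_coef; apply: subring_sum => i _.
by apply: subringM; [exact: Op | exact: subringX].
Qed.

Definition adjoin w : set L :=
  [set z | exists p : {poly L}, (forall i, O p`_i) /\ z = p.[w]].

Lemma adjoin_subring w : is_subring (adjoin w).
Proof.
split.
- exists 1; split=> [i|]; last by rewrite hornerC.
  by rewrite coef1; case: (i == 0)%N; [exact: subring1 | exact: subring0].
- move=> _ _ [p [Op ->]] [q [Oq ->]]; exists (p - q); split; last by rewrite !hornerE.
  by move=> i; rewrite coefB; apply: subringB.
- move=> _ _ [p [Op ->]] [q [Oq ->]]; exists (p * q); split; last by rewrite !hornerE.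
  by move=> i; rewrite coefM; apply: subring_sum => j _; apply: subringM.
Qed.

Lemma sub_adjoin w : O `<=` adjoin w.
Proof.
move=> z Oz; exists z%:P; split; last by rewrite hornerC.
by move=> i; rewrite coefC; case: (i == 0)%N => //; exact: subring0.
Qed.

Lemma mem_adjoin w : adjoin w w.
Proof.
exists 'X; split; last by rewrite hornerX.
by move=> i; rewrite coefX; case: (i == 1)%N; [exact: subring1 | exact: subring0].
Qed.

(* The descent on degrees in Chevalley's theorem: the equation of lower degree
   eliminates the leading term of the other one. *)
Lemma no_inverse_relations z w :
  (forall b, O b -> 1 + z * b != 0 /\ O (1 + z * b)^-1) -> O z -> ~ O z^-1 ->
  w != 0 -> forall p q : {poly L},
  (forall i, O p`_i) -> (forall i, O q`_i) ->
  z * p.[w] = 1 -> z * q.[w^-1] = 1 -> False.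
Proof.
move=> Ou Oz Ozi + p q; have [N le_pqN] := ubnP (size p + size q).
elim: N => // N IH in w p q le_pqN *.
(* Exchanging [w] with [w^-1] and [p] with [q] preserves both relations. *)
wlog le_qp : w p q le_pqN / (size q <= size p)%N.
  move=> wl w0 Op Oq pw qw; case: (leqP (size q) (size p)) => [le|/ltnW le].
    exact: (wl w p q).
  by apply: (wl w^-1 q p) => //; rewrite ?invrK ?invr_eq0 // addnC.
move=> w0 Op Oq pw qw.
have z0 : z != 0 by apply/eqP => z0; move/eqP: pw; rewrite z0 mul0r eq_sym oner_eq0.
pose q1 := drop_poly 1 q.
have qE : q = q1 * 'X + (q`_0)%:P.
  rewrite -{1}(poly_take_drop 1 q) addrC; congr (_ + _).
  by apply/polyP=> -[|i]; rewrite coef_take_poly coefC.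
set u := 1 - z * q`_0.
have [u0 Oui] : u != 0 /\ O u^-1.
  by rewrite /u -mulrN; apply/Ou/subringN.
have q1E : z * q1.[w^-1] * w^-1 = u.
  have qw' : z * (q1.[w^-1] * w^-1 + q`_0) = 1 by rewrite -qw [in RHS]qE !hornerE.
  by rewrite /u -qw'; ring.
have q1n0 : size q1 != 0%N.
  rewrite size_poly_eq0; apply/eqP => q10; move: q1E.
  by rewrite q10 horner0 mulr0 mul0r => /esym/eqP; rewrite (negPf u0).
have sq : size q1 = (size q).-1 by rewrite size_drop_poly subn1.
have /prednK sp : (0 < size p)%N by lia.
pose k := (size p).-1.
(* [r] is [q1] reversed, so [z * r.[w] = u * w ^+ k]. The leading term [c * w ^+ k] of [p] can thus
   be replaced by [c * u^-1 * z * r.[w]], of degree below [k]. *)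
pose r := \poly_(i < k) q1`_(k.-1 - i).
have k_gt0 : (0 < k)%N by rewrite /k; lia.
have rE : r.[w] = w ^+ k.-1 * q1.[w^-1].
  rewrite horner_poly (reindex_inj rev_ord_inj) /=.
  rewrite (@horner_coef_wide _ k); last by rewrite sq /k; lia.
  rewrite big_distrr /=; apply: eq_bigr => i _.
  have ik := ltn_ord i.
  have -> : (k.-1 - (k - i.+1))%N = i by lia.
  have -> : k.-1 = ((k - i.+1) + i)%N by lia.
  by rewrite exprD exprVn mulrACA divff ?expf_neq0 // mulr1 mulrC.
pose c := p`_k.
have pE : p = take_poly k p + c *: 'X^k.
  rewrite -{1}(poly_take_drop k p); congr (_ + _).
  have s1 : (size (drop_poly k p) <= 1)%N by rewrite size_drop_poly /k; lia.
  by rewrite (size1_polyC s1) coef_drop_poly add0n mul_polyC.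
pose p1 := take_poly k p + (c * u^-1 * z) *: r.
apply: (IH w p1 q) => //.
- have : (size p1 <= k)%N.
    rewrite (leq_trans (size_polyD _ _)) // geq_max size_take_poly /=.
    by rewrite (leq_trans (size_scale_leq _ _)) // size_poly.
  by rewrite /k; lia.
- move=> i; rewrite coefD coefZ; apply: subringD.
    rewrite coef_take_poly; case: ifP => _ //; exact: subring0.
  apply: subringM; first by do 2?apply: subringM => //; exact: Op.
  rewrite coef_poly; case: ifP => _; last exact: subring0.
  by rewrite coef_drop_poly; exact: Oq.
rewrite -pw [in RHS]pE /p1 !hornerE rE; congr (z * (_ + _)).
have -> : w ^+ k = w ^+ k.-1 * w by rewrite -exprSr prednK.
have zv : z * q1.[w^-1] = u * w by rewrite -q1E mulfVK.
transitivity (c * u^-1 * (z * q1.[w^-1]) * w ^+ k.-1); first by ring.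
by rewrite zv; field.
Qed.

End Subrings.

(* Chevalley: a maximal subring containing A and no inverse of an element of S
   is a valuation ring. *)
Lemma valuation_overring (L : fieldType) (A S : set L) :
  is_subring A -> S `<=` A -> (forall s, S s -> ~ A s^-1) ->
  (forall s s', S s -> S s' -> exists2 s0, S s0 &
     (exists2 a, A a & s = s0 * a) /\ (exists2 a, A a & s' = s0 * a)) ->
  exists B : set L, [/\ is_subring B, A `<=` B, forall s, S s -> ~ B s^-1
                      & forall z, B z \/ B z^-1].
Proof.
move=> Ar SA SiA dirS.
pose good X := [/\ is_subring X, A `<=` X & forall s, S s -> ~ X s^-1].
pose P X := X = set0 \/ good X.
have [|B [PB Bmax]] := @Zorn_bigcup L P.
  move=> F FP Ftot.
  have [[X FX [x Xx]]|F0] := pselect (exists2 X, F X & X !=set0); last first.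
    left; apply/seteqP; split => // x [X FX Xx].
    by case: F0; exists X => //; exists x.
  right.
  have gd Y y : F Y -> Y y -> good Y.
    by move=> FY Yy; have [Y0|//] := FP _ FY; move: Yy; rewrite Y0.
  have [Xr AX SX] := gd _ _ FX Xx.
  have cup Y Z y z : F Y -> F Z -> Y y -> Z z ->
      exists W, [/\ F W, W y, W z & is_subring W].
    move=> FY FZ Yy Zz; have [YZ|ZY] := Ftot _ _ FY FZ.
      by exists Z; split => //; [exact: YZ | case: (gd _ _ FZ Zz)].
    by exists Y; split => //; [exact: ZY | case: (gd _ _ FY Yy)].
  split.
  - split; first by exists X => //; apply: subring1.
    + move=> y z [Y FY Yy] [Z FZ Zz]; have [W [FW Wy Wz Wr]] := cup _ _ _ _ FY FZ Yy Zz.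
      by exists W => //; apply: subringB.
    + move=> y z [Y FY Yy] [Z FZ Zz]; have [W [FW Wy Wz Wr]] := cup _ _ _ _ FY FZ Yy Zz.
      by exists W => //; apply: subringM.
  - by move=> a Aa; exists X => //; apply: AX.
  - by move=> s Ss [Y FY Ys]; have [_ _ SY] := gd _ _ FY Ys; apply: SY Ys.
have A1 := subring1 Ar.
have [Br AB SB] : good B.
  have [B0|//] := PB; exfalso; apply: (Bmax A); last by right; split.
  by rewrite B0; split=> // /(_ 1 A1).
have maxB C : is_subring C -> B `<=` C -> ~ C `<=` B ->
    exists2 s, S s & C s^-1.
  move=> Cr BC CB; apply: contrapT => noS.
  apply: (Bmax C); first by split.
  right; split=> //; first by move=> a /AB/BC.
  by move=> s Ss Cs; apply: noS; exists s.
exists B; split=> // w; apply: contrapT => /not_orP [Bw Bwi].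
have w0 : w != 0 by apply/eqP => w0; apply: Bw; rewrite w0; apply: subring0.
have nadj v : ~ B v -> exists2 s, S s & adjoin B v s^-1.
  move=> Bv; apply: maxB; [exact: adjoin_subring | exact: sub_adjoin|].
  by move=> /(_ v (mem_adjoin Br v)).
have [s1 Ss1 as1] := nadj _ Bw.
have [s2 Ss2 as2] := nadj _ Bwi.
have [z Sz [[a1 Aa1 s1E] [a2 Aa2 s2E]]] := dirS _ _ Ss1 Ss2.
have nz s : S s -> s != 0.
  move=> Ss; apply/eqP => s0; apply: (SB _ Ss).
  by rewrite s0 invr0; apply: subring0.
have z0 := nz _ Sz.
have adjz s a v : S s -> A a -> s = z * a -> adjoin B v s^-1 ->
    exists2 p : {poly L}, (forall i, B p`_i) & z * p.[v] = 1.
  move=> Ss Aa sE [p [Bp pE]]; exists (a *: p).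
    by move=> i; rewrite coefZ; apply: subringM => //; apply: AB.
  by rewrite hornerZ mulrA -sE -pE divff ?nz.
have [p Bp pw] := adjz _ _ _ Ss1 Aa1 s1E as1.
have [q Bq qw] := adjz _ _ _ Ss2 Aa2 s2E as2.
apply: (@no_inverse_relations _ B Br z w _ _ _ w0 p q) => //; last first.
- exact: SB.
- by apply/AB/SA.
have zB b : B b -> 1 + z * b != 0.
  move=> Bb; apply/eqP => zb; apply: (SB _ Sz).
  have -> : z^-1 = - b; last exact: subringN.
  apply: (mulfI z0); rewrite divff // mulrN; apply/eqP.
  by rewrite -addr_eq0 zb.
move=> b Bb; split; first exact: zB.
(* If [v^-1] were missing, adjoining it would give [s^-1] as a polynomial in [v^-1]. Clearing
   denominators, [s * c = v ^+ k], which is 1 modulo [z]; a common divisor [s0] of [s] and [z] would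
   then be invertible in [B]. *)
set v := 1 + z * b; apply: contrapT => Bvi.
have [s Ss [r [Br' rE]]] := nadj _ Bvi.
have v0 : v != 0 := zB _ Bb.
have Bv : B v by apply: subringD => //; [apply: subring1 | apply: subringM => //; apply/AB/SA].
pose k := size r.
have [c Bc cE] : exists2 c, B c & s * c = v ^+ k.
  exists (v ^+ k * r.[v^-1]); last by rewrite -rE mulrCA divff ?mulr1 // nz.
  rewrite horner_coef big_distrr /=; apply: subring_sum => // i _.
  rewrite mulrCA; apply: subringM => //.
  rewrite exprVn -expfB_cond; last by rewrite (negPf v0) add0n; apply/ltnW/ltn_ord.
  exact: subringX.
have modz j : exists2 d, B d & v ^+ j = 1 + z * d.
  elim: j => [|j [d Bd dE]]; first by exists 0; rewrite ?mulr0 ?addr0 //; apply: subring0.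
  exists (d + b + z * b * d); last by rewrite exprS dE /v; ring.
  do ?[apply: subringD | apply: subringM] => //; exact/AB/SA.
have [s0 Ss0 [[a Aa sE] [a' Aa' zE]]] := dirS _ _ Ss Sz.
have [d Bd dE] := modz k.
apply: (SB _ Ss0).
have -> : s0^-1 = a * c - a' * d.
  apply: (mulfI (nz _ Ss0)); rewrite divff ?nz // mulrBr !mulrA -sE -zE cE dE; ring.
by apply: subringB => //; apply: subringM => //; apply: AB.
Qed.

(** * Valuation rings and uniformizers *)

Definition nonunits (L : fieldType) (O : set L) : set L := O `\` ring_units O.

(** A relation rather than a function: it can be used before [t] is known to be prime or every
    element is known to have an order. [nu_has_val] converts it to [nu] afterwards. *)
Definition has_val (L : fieldType) (O : set L) (t z : L) (s : int) : Prop :=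
  exists2 u, ring_units O u & z = t ^ s * u.

Section ValuationRings.
Variables (L : fieldType) (O : set L).
Hypotheses (Oring : is_subring O) (Oval : forall z, O z \/ O z^-1).
Implicit Types (z w u : L) (s : int).

Lemma units1 : ring_units O 1.
Proof. by split; rewrite ?oner_neq0 ?invr1 //; apply: subring1. Qed.

Lemma unitsM u v : ring_units O u -> ring_units O v -> ring_units O (u * v).
Proof.
move=> [u0 Ou Oui] [v0 Ov Ovi]; split; first by rewrite mulf_neq0.
  exact: subringM.
by rewrite invfM; apply: subringM.
Qed.

Lemma unitsV u : ring_units O u -> ring_units O u^-1.
Proof. by move=> [u0 Ou Oui]; split; rewrite ?invr_eq0 ?invrK. Qed.

Lemma unitsX u k : ring_units O u -> ring_units O (u ^+ k).
Proof.
by move=> Uu; elim: k => [|k IH]; rewrite ?expr0 ?exprS; [apply: units1 | apply: unitsM].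
Qed.

Lemma unitsXz u s : ring_units O u -> ring_units O (u ^ s).
Proof.
by move=> Uu; case: s => k; rewrite ?NegzE -?exprnN; [|apply: unitsV]; apply: unitsX.
Qed.

Lemma nonunitsE z : nonunits O z <-> z = 0 \/ ~ O z^-1.
Proof.
split=> [[Oz Uz]|[->|Oz]].
- have [->|z0] := eqVneq z 0; first by left.
  by right=> Ozi; apply: Uz.
- by split; [apply: subring0 | case=> /eqP].
- by split; [have [] := Oval z | case].
Qed.

Lemma val_ring_nonunits : val_ring (nonunits O) = O.
Proof.
apply/seteqP; split=> z; rewrite /val_ring /= nonunitsE.
  move=> [->|]; first exact: subring0.
  move=> /not_orP [_]; rewrite invrK => /contrapT; exact.
move=> Oz; have [->|z0] := eqVneq z 0; first by left.
right=> -[/eqP|]; first by rewrite invr_eq0 (negPf z0).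
by rewrite invrK.
Qed.

(** The case of integral closure that is needed: if [z^-1] is in [O], then [z] is [z ^+ k] times a
    power of [z^-1]. *)
Lemma root_closed z k : (0 < k)%N -> O (z ^+ k) -> O z.
Proof.
move=> k0 Ozk; have [//|Ozi] := Oval z.
have [->|z0] := eqVneq z 0; first exact: subring0.
have -> : z = z ^+ k * z^-1 ^+ k.-1.
  by rewrite -{1}(prednK k0) exprS -mulrA exprVn divff ?mulr1 // expf_neq0.
by apply: subringM => //; apply: subringX.
Qed.

Lemma nonunitsM a z : O a -> nonunits O z -> nonunits O (a * z).
Proof.
move=> Oa; rewrite !nonunitsE; have [->|z0] := eqVneq z 0.
  by rewrite mulr0; left.
move=> [/eqP|Oz]; first by rewrite (negPf z0).
have [->|a0] := eqVneq a 0; first by rewrite mul0r; left.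
right=> Oaz; apply: Oz; have -> : z^-1 = a * (a * z)^-1 by rewrite invfM mulrA divff ?mul1r.
exact: subringM.
Qed.

Lemma nonunits0 : nonunits O 0. Proof. by apply/nonunitsE; left. Qed.

Lemma nonunitsD z w : nonunits O z -> nonunits O w -> nonunits O (z + w).
Proof.
have [->|z0] := eqVneq z 0; first by rewrite add0r.
have [->|w0] := eqVneq w 0; first by rewrite addr0.
move=> Mz Mw; have [Oq|Oq] := Oval (z / w).
  have -> : z + w = (z / w + 1) * w by rewrite mulrDl mul1r divfK.
  by apply: nonunitsM => //; apply: subringD => //; apply: subring1.
have -> : z + w = (1 + w / z) * z by rewrite mulrDl mul1r divfK.
apply: nonunitsM => //; apply: subringD => //; first exact: subring1.
by move: Oq; rewrite invfM invrK mulrC.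
Qed.

Lemma nonunitsN z : nonunits O z -> nonunits O (- z).
Proof. by rewrite -mulN1r; apply: nonunitsM; apply: subringN => //; apply: subring1. Qed.

Lemma nonunits_sum (I : Type) (r : seq I) (P : pred I) (F : I -> L) :
  (forall i, P i -> nonunits O (F i)) -> nonunits O (\sum_(i <- r | P i) F i).
Proof. by move=> MF; apply: big_ind => //; [exact: nonunits0 | exact: nonunitsD]. Qed.

Lemma unitsDr u z : ring_units O u -> nonunits O z -> ring_units O (u + z).
Proof.
move=> Uu Mz; have [u0 Ou Oui] := Uu; have [Oz nUz] := Mz.
apply: contrapT => nU; have Muz : nonunits O (u + z) by split => //; apply: subringD.
have [_ []] : nonunits O u by rewrite -(addrK z u); apply/nonunitsD/nonunitsN.
exact: Uu.
Qed.

Section Uniformizer.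
Variable t : L.
Hypotheses (Mt : nonunits O t) (t0 : t != 0).
Notation hv := (has_val O t).

Lemma has_val_neq0 z s : hv z s -> z != 0.
Proof. by case=> u [u0 _ _] ->; rewrite mulf_neq0 // expfz_neq0. Qed.

Lemma has_val_unit u : ring_units O u -> hv u 0.
Proof. by exists u; rewrite ?expr0z ?mul1r. Qed.

Lemma has_valXz s : hv (t ^ s) s.
Proof. by exists 1; rewrite ?mulr1 //; apply: units1. Qed.

Lemma has_val_t : hv t 1.
Proof. by have := has_valXz 1; rewrite expr1z. Qed.

Lemma has_valM z w s s' : hv z s -> hv w s' -> hv (z * w) (s + s').
Proof.
move=> [u Uu ->] [v Uv ->]; exists (u * v); first exact: unitsM.
by rewrite expfzDr // mulrACA.
Qed.

Lemma has_valV z s : hv z s -> hv z^-1 (- s).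
Proof.
by move=> [u Uu ->]; exists u^-1; [exact: unitsV | rewrite invfM invr_expz].
Qed.

Lemma has_valX z s k : hv z s -> hv (z ^+ k) (s * k%:Z).
Proof.
move=> [u Uu ->]; exists (u ^+ k); first exact: unitsX.
by rewrite exprMn -exprz_exp.
Qed.

Lemma has_val_Xz z s (k : int) : hv z s -> hv (z ^ k) (s * k).
Proof.
case: k => k hz; first exact: has_valX.
by rewrite NegzE -exprnN mulrN; apply: has_valV; apply: has_valX.
Qed.

Lemma nonunits_expr k : (0 < k)%N -> nonunits O (t ^+ k).
Proof.
by case: k => // k _; rewrite exprSr; apply: nonunitsM => //; apply: subringX => //; case: Mt.
Qed.

Lemma has_val_nonunit z s : hv z s -> 0 < s -> nonunits O z.
Proof.
move=> [u [u0 Ou _] ->]; case: s => // k k_gt0.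
by rewrite mulrC; apply: nonunitsM => //; apply: nonunits_expr.
Qed.

Lemma has_val_nonunitP z s : hv z s -> (nonunits O z <-> 0 < s).
Proof.
move=> hz; split; last exact: has_val_nonunit.
move=> Mz; rewrite ltNge; apply/negP => s_le0.
have [Oz nU] := Mz; apply: nU; split; rewrite ?(has_val_neq0 hz) //.
have hzi := has_valV hz; have [s0|s0] := eqVneq s 0.
  by move: hz; rewrite s0 => -[u Uu ->]; rewrite expr0z mul1r; case: Uu.
by case: (has_val_nonunit hzi) => //; lia.
Qed.

Lemma has_val_ringP z s : hv z s -> (O z <-> 0 <= s).
Proof.
move=> hz; have z0 := has_val_neq0 hz; split=> [Oz|s_ge0].
  rewrite leNgt; apply/negP => s_lt0.
  have : nonunits O z^-1 by apply: (has_val_nonunit (has_valV hz)); lia.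
  by move/nonunitsE => [/eqP|]; rewrite ?invr_eq0 ?(negPf z0) // invrK.
have [s0|s0] := eqVneq s 0.
  by move: hz; rewrite s0 => -[u [u0 Ou _] ->]; rewrite expr0z mul1r.
by case: (has_val_nonunit hz) => //; lia.
Qed.

Lemma has_val_uniq z s s' : hv z s -> hv z s' -> s = s'.
Proof.
move=> hz hz'; have z0 := has_val_neq0 hz.
have h1 : hv 1 (s - s') by rewrite -(divff z0); apply: has_valM => //; apply: has_valV.
have /(has_val_ringP h1) ge : O 1 by apply: subring1.
have : ~ nonunits O 1 by case=> _; apply; apply: units1.
by rewrite (has_val_nonunitP h1); lia.
Qed.

(** After division by [t ^ s i0] the minimal term is a unit and every other term a nonunit, so no
    cancellation can occur. *)
Lemma has_val_sum (I : finType) (z : I -> L) (s : I -> int) :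
  (forall i, z i != 0 -> hv (z i) (s i)) ->
  (forall i j, z i != 0 -> z j != 0 -> s i = s j -> i = j) ->
  (exists i, z i != 0) ->
  exists i0, [/\ z i0 != 0, hv (\sum_i z i) (s i0)
                & forall i, z i != 0 -> s i0 <= s i].
Proof.
move=> hz sinj [i1 zi1].
case: (@Order.TotalTheory.arg_minP _ _ _ i1 (fun i => z i != 0) s zi1) => i0 zi0 min0.
exists i0; split=> //; rewrite (bigD1 i0) //=.
have [u Uu zE] := hz _ zi0.
exists (u + t ^ (- s i0) * \sum_(i | i != i0) z i); last first.
  by rewrite mulrDr -zE mulrA -expfzDr // subrr expr0z mul1r.
apply: unitsDr => //; rewrite big_distrr /=; apply: nonunits_sum => i ii0.
have [->|zi] := eqVneq (z i) 0; first by rewrite mulr0; apply: nonunits0.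
apply: (has_val_nonunit (has_valM (has_valXz _) (hz _ zi))).
suff : s i0 != s i by have := min0 _ zi; lia.
by apply: contra ii0 => /eqP /sinj -> .
Qed.

Lemma prime_elementP :
  (forall z, z != 0 -> exists s, hv z s) -> prime_element (nonunits O) t.
Proof.
move=> allv; rewrite /prime_element val_ring_nonunits.
apply/seteqP; split=> z /=; last first.
  by move=> [w Ow <-]; rewrite mulrC; apply: nonunitsM.
move=> Mz; have [->|z0] := eqVneq z 0.
  by exists 0; rewrite ?mulr0 //; apply: subring0.
have [s hz] := allv _ z0; exists (z / t); last by rewrite mulrC divfK.
apply/(has_val_ringP (has_valM hz (has_valV has_val_t))).
by move/(has_val_nonunitP hz): Mz; lia.
Qed.

End Uniformizer.

(** Two prime elements differ by a unit, so the value of [nu] does not depend on the one chosen. *)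
Lemma has_val_prime t t' z s : t != 0 -> prime_element (nonunits O) t ->
  prime_element (nonunits O) t' -> has_val O t' z s -> has_val O t z s.
Proof.
rewrite /prime_element val_ring_nonunits => t0 pt pt' [u Uu ->].
have [a Oa taE] : [set t * w | w in O] t'.
  by rewrite -pt pt'; exists 1; rewrite ?mulr1 //; apply: subring1.
have [b Ob tbE] : [set t' * w | w in O] t.
  by rewrite -pt' pt; exists 1; rewrite ?mulr1 //; apply: subring1.
have ab : a * b = 1 by apply: (mulfI t0); rewrite mulr1 mulrA taE.
have a0 : a != 0.
  by apply/eqP => a0; move/eqP: ab; rewrite a0 mul0r eq_sym oner_eq0.
have ai : a^-1 = b by apply: (mulfI a0); rewrite divff.
have ht' : has_val O t t' 1 by exists a; rewrite ?expr1z //; split=> //; rewrite ai.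
have := has_valM t0 (has_val_Xz s ht') (has_val_unit t Uu).
by rewrite mul1r addr0.
Qed.

Lemma nu_has_val t z s : nonunits O t -> t != 0 ->
  prime_element (nonunits O) t -> has_val O t z s -> nu (nonunits O) z = s.
Proof.
move=> Mt t0 pt hz; apply: xget_unique.
  by case: hz => u Uu zE; exists t, u; rewrite val_ring_nonunits.
move=> n [t' [u [pt']]]; rewrite val_ring_nonunits => Uu zE.
have h' : has_val O t' z n by exists u.
exact: (has_val_uniq Mt t0 (has_val_prime t0 pt pt' h') hz).
Qed.

(** The default value of [nu] being 0, a nonzero value certifies that a prime element exists. *)
Lemma nu_neq0 z : nu (nonunits O) z != 0 ->
  exists t, prime_element (nonunits O) t /\ has_val O t z (nu (nonunits O) z).
Proof.
rewrite /nu; case: xgetP => [n _ [t [u []]]|]; last by rewrite eqxx.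
by rewrite val_ring_nonunits => pt Uu zE _; exists t; split=> //; exists u.
Qed.

Lemma prime_element_nonunit t : prime_element (nonunits O) t -> nonunits O t.
Proof.
rewrite /prime_element val_ring_nonunits => pt; rewrite pt.
by exists 1; rewrite ?mulr1 //; apply: subring1.
Qed.

End ValuationRings.

(** * Places of the rational function field *)

(** Unlike [valuation_ring], this allows the whole field, as restrictions and preimages of rings
    require. Properness is supplied separately by a nonzero nonunit. *)
Definition is_vring (k L : fieldType) (iota : {rmorphism k -> L}) (O : set L) : Prop :=
  [/\ is_subring O, forall z, O z \/ O z^-1 & forall c, O (iota c)].

Section Places.
Variables (k L : fieldType) (iota : {rmorphism k -> L}).

Lemma units_const (O : set L) c : is_vring iota O -> c != 0 -> ring_units O (iota c).
Proof.
by move=> [_ _ Oc] c0; split; rewrite ?fmorph_eq0 // -fmorphV; apply: Oc.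
Qed.

Lemma place_nonunits (O : set L) t :
  is_vring iota O -> t != 0 -> nonunits O t -> place iota (nonunits O).
Proof.
move=> Ov t0 Mt; have [Or Oval Oc] := Ov; exists O => //; split=> //.
- exact/is_subringP.
- split; first by move=> _ [c _ <-]; apply: Oc.
  move=> /(_ t (proj1 Mt)) [c _ ct]; move: t0 Mt; rewrite -ct fmorph_eq0 => c0.
  by case=> _; apply; apply: units_const.
- split=> // /(_ t^-1) Oti.
  by case/(nonunitsE Or Oval): Mt => [/eqP|]; rewrite ?(negPf t0) //; apply; apply: Oti.
Qed.

Lemma placeP (A : set L) : place iota A ->
  exists O t, [/\ is_vring iota O, t != 0, nonunits O t & A = nonunits O].
Proof.
move=> [O [/is_subringP Or ltO Olt Oval] ->].
have Ov : is_vring iota O by split=> // c; apply: (proj1 ltO); exists c.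
have [t Ot] : exists t, ~ O t.
  apply: contrapT => noO; case: Olt => _; apply=> z _; apply: contrapT => Oz.
  by apply: noO; exists z.
exists O, t^-1; split=> //.
  by rewrite invr_eq0; apply/eqP => t0; apply: Ot; rewrite t0; apply: subring0.
by apply/nonunitsE => //; right; rewrite invrK.
Qed.

End Places.

Lemma frac_numden (K : fieldType) (z : {fraction {poly K}}) :
  exists p q : {poly K}, [/\ q != 0, coprimep p q & z = tofrac p / tofrac q].
Proof.
have [p [q [q0 ->]]] : exists p q, q != 0 /\ z = tofrac p / tofrac q.
  elim/quotW: z => x; exists \n_x, \d_x; split; first exact: denom_ratioP.
  apply: (mulIf (x := tofrac \d_x)); first by rewrite tofrac_eq0 denom_ratioP.
  rewrite divfK ?tofrac_eq0 ?denom_ratioP // !piE.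
  apply/eqmodP; rewrite /= FracField.equivfE /FracField.mulf.
  rewrite !numden_Ratio ?oner_eq0 ?mulr1 ?denom_ratioP //.
  by rewrite mulrC.
have d0 : gcdp p q != 0 by rewrite gcdp_eq0 (negPf q0) andbF.
exists (p %/ gcdp p q), (q %/ gcdp p q); split.
- by rewrite divp_eq0 (negPf q0) (negPf d0) /= -leqNgt leq_gcdpr.
- by apply: coprimep_div_gcd; rewrite q0 orbT.
have {1}-> : p = p %/ gcdp p q * gcdp p q by rewrite divpK // dvdp_gcdl.
have {3}-> : q = q %/ gcdp p q * gcdp p q by rewrite divpK // dvdp_gcdr.
by rewrite !tofracM -mulf_div divff ?mulr1 // tofrac_eq0.
Qed.

Lemma exprVNz (L : fieldType) (x : L) (d : nat) : x^-1 ^ (- d%:Z) = x ^+ d.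
Proof. by rewrite -exprnN exprVn invrK. Qed.

Section RationalFunctions.
Variable K : fieldType.
Variables (E : fieldType) (tf : {rmorphism {poly K} -> E}).
Hypotheses (tf_inj : injective tf)
  (tf_frac : forall z, exists p q : {poly K}, [/\ q != 0, coprimep p q & z = tf p / tf q]).
Notation X := (tf 'X).

(** For [tf = tofrac] this is [ratfun_const] by conversion, so results about an abstract [tf] apply
    directly to the field of fractions. *)
Definition rat_cst : {rmorphism K -> E} := tf \o polyC.
Notation cst := rat_cst.
Notation vringE := (is_vring cst).
Implicit Types (O : set E) (z : E) (p q : {poly K}).

Lemma tf_eq p q : (tf p == tf q) = (p == q). Proof. exact: (inj_eq tf_inj). Qed.

Lemma tf_eq0 p : (tf p == 0) = (p == 0). Proof. by rewrite -(rmorph0 tf) tf_eq. Qed.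

Lemma tf_sum p : tf p = \sum_(i < size p) cst p`_i * X ^+ i :> E.
Proof.
rewrite -{1}[p]coefK poly_def rmorph_sum; apply: eq_bigr => i _.
by rewrite -mul_polyC rmorphM rmorphXn.
Qed.

Lemma vring_poly O p : vringE O -> O X -> O (tf p).
Proof.
move=> [Or _ Oc] OX; rewrite tf_sum; apply: subring_sum => // i _.
by apply: subringM => //; apply: subringX.
Qed.

(* Rational places are indexed by option K, None being the place at infinity. *)
Definition unif (b : option K) : E :=
  if b is Some c then tf ('X - c%:P) else X^-1.

Lemma unif_neq0 b : unif b != 0.
Proof.
by case: b => [c|] /=; rewrite ?invr_eq0 tf_eq0 ?polyXsubC_eq0 ?polyX_eq0.
Qed.

Lemma unif_Some_X O c : vringE O -> O (unif (Some c)) -> O X.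
Proof.
move=> [Or _ Oc] Ou; have -> : X = unif (Some c) + cst c.
  by rewrite /= -rmorphD subrK.
exact: subringD.
Qed.

Lemma poly_res_Some O c q : vringE O -> nonunits O (unif (Some c)) ->
  nonunits O (tf q - cst q.[c]).
Proof.
move=> Ov Mu; have [Or Oval Oc] := Ov.
have /factor_theorem [r rE] : root (q - q.[c]%:P) c by rewrite /root !hornerE subrr.
have -> : tf q - cst q.[c] = tf r * unif (Some c) by rewrite /= -rmorphM -rE rmorphB.
by apply: nonunitsM => //; apply: vring_poly => //; apply: unif_Some_X Ov (proj1 Mu).
Qed.

Lemma poly_res_None O p : vringE O -> nonunits O (unif None) -> p != 0 ->
  nonunits O (tf p / X ^+ (size p).-1 - cst (lead_coef p)).
Proof.
move=> Ov Mu p0; have [Or Oval Oc] := Ov.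
have X0 : X != 0 by rewrite tf_eq0 polyX_eq0.
have sp : size p = (size p).-1.+1 by rewrite prednK // size_poly_gt0.
rewrite tf_sum sp big_ord_recr /= mulrDl mulfK ?expf_neq0 // addrK.
rewrite big_distrl /=; apply: nonunits_sum => // i _; rewrite -mulrA.
apply: nonunitsM => //; first exact: Oc.
have -> : X ^+ i / X ^+ (size p).-1 = unif None ^+ ((size p).-1 - i).
  by rewrite /= exprVn expfB // invf_div.
apply: nonunits_expr => //; by rewrite subn_gt0.
Qed.

Lemma unit_of_residue O u c : vringE O -> c != 0 -> nonunits O (u - cst c) -> ring_units O u.
Proof.
move=> Ov c0 Mu; have [Or Oval Oc] := Ov.
by rewrite -(subrK (cst c) u) addrC; apply: unitsDr => //; apply: (units_const Ov).
Qed.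

Lemma residueM O u u' c c' : vringE O -> O u ->
  nonunits O (u - cst c) -> nonunits O (u' - cst c') -> nonunits O (u * u' - cst (c * c')).
Proof.
move=> Ov Ou Mu Mu'; have [Or Oval Oc] := Ov.
have -> : u * u' - cst (c * c') = u * (u' - cst c') + cst c' * (u - cst c).
  by rewrite rmorphM /=; ring.
by apply: nonunitsD => //; apply: nonunitsM.
Qed.

Lemma residueV O u c : vringE O -> c != 0 ->
  nonunits O (u - cst c) -> nonunits O (u^-1 - cst c^-1).
Proof.
move=> Ov c0 Mu; have [Or Oval Oc] := Ov.
have [u0 _ Oui] := unit_of_residue Ov c0 Mu.
have -> : u^-1 - cst c^-1 = (- u^-1 * cst c^-1) * (u - cst c).
  have : cst c != 0 by rewrite fmorph_eq0.
  by rewrite fmorphV; move: (cst c) => k k0; field; rewrite ?u0 ?k0.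
by apply: nonunitsM => //; apply: subringM => //; apply: subringN.
Qed.

(* The valuation s and the residue c do not depend on O: this is what makes the
   valuation ring centred at a rational place unique. *)
Lemma rat_val_residue b z : z != 0 -> exists (s : int) (c : K), c != 0 /\
  forall O, vringE O -> nonunits O (unif b) ->
    exists2 u, nonunits O (u - cst c) & z = unif b ^ s * u.
Proof.
have polyv p : p != 0 -> exists (s : int) (c : K), c != 0 /\
    forall O, vringE O -> nonunits O (unif b) ->
      exists2 u, nonunits O (u - cst c) & tf p = unif b ^ s * u.
  move=> p0; case: b => [a|]; last first.
    exists (- (size p).-1%:Z), (lead_coef p); rewrite lead_coef_eq0; split=> // O Ov Mu.
    exists (tf p / X ^+ (size p).-1); first exact: poly_res_None.
    by rewrite exprVNz mulrC divfK // expf_neq0 // tf_eq0 polyX_eq0.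
  have [k [q + pE]] := multiplicity_XsubC p a; rewrite p0 pE => qa.
  exists k%:Z, q.[a]; split=> // O Ov Mu; exists (tf q); first exact: poly_res_Some.
  by rewrite rmorphM rmorphXn mulrC.
have [p [q [q0 _ ->]]] := tf_frac z.
rewrite mulf_eq0 negb_or tf_eq0 => /andP[p0 _].
have [s [c [c0 hs]]] := polyv _ p0; have [s' [c' [c'0 hs']]] := polyv _ q0.
exists (s - s'), (c / c'); rewrite mulf_neq0 ?invr_eq0 //; split=> // O Ov Mu.
have [u Mu' ->] := hs _ Ov Mu; have [u' Mu'' ->] := hs' _ Ov Mu.
exists (u / u'); last by rewrite expfzDr ?unif_neq0 // -invr_expz invfM mulrACA.
apply: residueM => //; last exact: residueV.
by case: (unit_of_residue Ov c0 Mu').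
Qed.

Lemma rat_val b z : z != 0 -> exists s : int, forall O, vringE O ->
  nonunits O (unif b) -> has_val O (unif b) z s.
Proof.
move=> /(rat_val_residue b) [s [c [c0 hs]]]; exists s => O Ov Mu.
by have [u Mu' ->] := hs _ Ov Mu; exists u => //; apply: unit_of_residue Mu'.
Qed.

Lemma poly_val_None O p : vringE O -> nonunits O (unif None) -> p != 0 ->
  has_val O (unif None) (tf p) (- (size p).-1%:Z).
Proof.
move=> Ov Mu p0; exists (tf p / X ^+ (size p).-1); last first.
  by rewrite exprVNz mulrC divfK // expf_neq0 // tf_eq0 polyX_eq0.
by apply: (unit_of_residue Ov _ (poly_res_None Ov Mu p0)); rewrite lead_coef_eq0.
Qed.

Lemma range_tf_subring : is_subring (range tf).
Proof.
split; first by exists 1; rewrite ?rmorph1.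
  by move=> _ _ [p _ <-] [q _ <-]; exists (p - q); rewrite ?rmorphB.
by move=> _ _ [p _ <-] [q _ <-]; exists (p * q); rewrite ?rmorphM.
Qed.

(** Chevalley's theorem over the polynomial ring: the inverse of a nonconstant [p] is not a
    polynomial, so some valuation ring containing [X] is centred at a zero of [p], rational or
    not. *)
Lemma vring_poly_nonunit p : (1 < size p)%N ->
  exists O, [/\ vringE O, O X & ~ O (tf p)^-1].
Proof.
move=> sp; have p0 : p != 0 by rewrite -size_poly_gt0 ltnW.
have [| | | |O [Or AO SO Oval]] := @valuation_overring _
    (range tf) [set tf p].
- exact: range_tf_subring.
- by move=> _ ->; exists p.
- move=> _ -> [q _ qE]; have /eqP : tf (q * p) = 1 :> E.
    by rewrite rmorphM /= qE mulVf // tf_eq0.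
  rewrite -(rmorph1 tf) tf_eq => /eqP qp1; have := size_poly1 K; rewrite -qp1.
  have q0 : q != 0 by apply: contra_eq_neq qp1 => ->; rewrite mul0r eq_sym oner_eq0.
  have sq : (0 < size q)%N by rewrite size_poly_gt0.
  have arith a b : (0 < a)%N -> (1 < b)%N -> (a + b).-1 = 1%N -> False by lia.
  by rewrite size_mul // => /(arith _ _ sq sp).
- move=> _ _ -> ->; exists (tf p) => //.
  by split; exists 1; rewrite ?mulr1 //; exists 1; rewrite ?rmorph1.
exists O; split=> //; last exact: SO.
- by split=> // c; apply: AO; exists c%:P.
- by apply: AO; exists 'X.
Qed.

(** The same construction over the polynomials in [X^-1], written as fractions [p / X^k] with [p] of
    degree at most [k]. *)
Lemma vring_inf : exists O, vringE O /\ ~ O X.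
Proof.
have X0 : X != 0 by rewrite tf_eq0 polyX_eq0.
have sizeM p q k l : (size p <= k.+1)%N -> (size q <= l.+1)%N ->
    (size (p * q)%R <= (k + l).+1)%N.
  have arith a b : (a <= k.+1)%N -> (b <= l.+1)%N -> ((a + b).-1 <= (k + l).+1)%N by lia.
  by move=> sp sq; apply: leq_trans (size_polyMleq _ _) (arith _ _ sp sq).
pose A : set E := [set z | exists p k, (size p <= k.+1)%N /\ z = tf p / X ^+ k].
have [| | | |O [Or AO SO Oval]] := @valuation_overring _ A [set X^-1].
- split.
  + by exists 1, 0%N; rewrite size_poly1 rmorph1 expr0 divr1.
  + move=> _ _ [p [k [sp ->]]] [q [l [sq ->]]]; exists (p * 'X^l - q * 'X^k), (k + l)%N.
    split; last by rewrite rmorphB !rmorphM !rmorphXn /= exprD; field; rewrite !expf_neq0.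
    rewrite (leq_trans (size_polyD _ _)) // geq_max size_polyN.
    by apply/andP; split; [|rewrite addnC]; apply: sizeM; rewrite ?size_polyXn.
  + move=> _ _ [p [k [sp ->]]] [q [l [sq ->]]]; exists (p * q), (k + l)%N.
    split; last by rewrite rmorphM exprD mulf_div.
    exact: sizeM.
- by move=> _ ->; exists 1, 1%N; rewrite size_poly1 rmorph1 expr1 div1r.
- move=> _ -> [p [k [sp]]]; rewrite invrK => XE.
  have /eqP : tf ('X^(k.+1)) = tf p :> E.
    by rewrite rmorphXn exprS {1}XE divfK // expf_neq0.
  by rewrite tf_eq => /eqP pE; move: sp; rewrite -pE size_polyXn ltnn.
- move=> _ _ -> ->; exists X^-1 => //.
  by split; exists 1; rewrite ?mulr1 //; exists 1, 0%N; rewrite size_poly1 rmorph1 expr0 divr1.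
exists O; split; last by have := SO X^-1; rewrite invrK; apply.
split=> // c; apply: AO; exists c%:P, 0%N; rewrite expr0 divr1; split=> //.
by rewrite size_polyC; case: (c != 0).
Qed.

Lemma rat_ring_ex b : exists O, vringE O /\ nonunits O (unif b).
Proof.
case: b => [c|].
  have [|O [Ov OX Oi]] := @vring_poly_nonunit ('X - c%:P); first by rewrite size_XsubC.
  by exists O; split=> //; have [Or Oval _] := Ov; apply/nonunitsE => //; right.
have [O [Ov OX]] := vring_inf; exists O; split=> //.
by have [Or Oval _] := Ov; apply/nonunitsE => //; right; rewrite invrK.
Qed.

Definition rat_ring b : set E := xget setT [set O | vringE O /\ nonunits O (unif b)].

Definition rat_place b : set E := nonunits (rat_ring b).

Lemma rat_ringP b : vringE (rat_ring b) /\ nonunits (rat_ring b) (unif b).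
Proof. exact: (xgetPex setT (rat_ring_ex b)). Qed.

(** By [rat_val] each [z] has one exponent valid in every such ring, and its sign decides
    membership. *)
Lemma rat_ring_uniq b O : vringE O -> nonunits O (unif b) -> O = rat_ring b.
Proof.
move=> Ov Mu; have [Ov' Mu'] := rat_ringP b.
have [Or Oval _] := Ov; have [Or' Oval' _] := Ov'.
apply/seteqP; split=> z.
  have [->|z0] := eqVneq z 0; first by move=> _; apply: subring0.
  have [s hs] := rat_val b z0.
  by move/(has_val_ringP Or Oval Mu (unif_neq0 b) (hs _ Ov Mu));
     move/(has_val_ringP Or' Oval' Mu' (unif_neq0 b) (hs _ Ov' Mu')).
have [->|z0] := eqVneq z 0; first by move=> _; apply: subring0.
have [s hs] := rat_val b z0.
by move/(has_val_ringP Or' Oval' Mu' (unif_neq0 b) (hs _ Ov' Mu'));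
   move/(has_val_ringP Or Oval Mu (unif_neq0 b) (hs _ Ov Mu)).
Qed.

Lemma rat_place_place b : place cst (rat_place b).
Proof. by have [Ov Mu] := rat_ringP b; apply: place_nonunits Mu => //; apply: unif_neq0. Qed.

Lemma prime_unif b : prime_element (rat_place b) (unif b).
Proof.
have [Ov Mu] := rat_ringP b; have [Or Oval _] := Ov.
apply: prime_elementP => // [|z z0]; first exact: unif_neq0.
by have [s hs] := rat_val b z0; exists s; apply: hs.
Qed.

Lemma rat_nu b z : z != 0 -> has_val (rat_ring b) (unif b) z (nu (rat_place b) z).
Proof.
move=> z0; have [Ov Mu] := rat_ringP b; have [Or Oval _] := Ov.
have [s hs] := rat_val b z0.
by rewrite (nu_has_val Or Oval Mu (unif_neq0 b) (prime_unif b) (hs _ Ov Mu)); apply: hs.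
Qed.

Lemma rat_nuE b z s : has_val (rat_ring b) (unif b) z s -> nu (rat_place b) z = s.
Proof.
have [[Or Oval _] Mu] := rat_ringP b.
exact: (nu_has_val Or Oval Mu (unif_neq0 b) (prime_unif b)).
Qed.

Lemma rat_residue b z : z != 0 -> nu (rat_place b) z = 0 ->
  exists c, nonunits (rat_ring b) (z - cst c).
Proof.
move=> z0 nz; have [Ov Mu] := rat_ringP b; have [Or Oval _] := Ov.
have [s [c [c0 hs]]] := rat_val_residue b z0; have [u Mu' zE] := hs _ Ov Mu.
have s0 : s = 0.
  by rewrite -nz; apply/esym/rat_nuE; exists u => //; apply: unit_of_residue Mu'.
by exists c; rewrite zE s0 expr0z mul1r.
Qed.

Lemma rat_nuM b z w : z != 0 -> w != 0 ->
  nu (rat_place b) (z * w) = nu (rat_place b) z + nu (rat_place b) w.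
Proof.
move=> z0 w0; apply/rat_nuE; have [[Or Oval _] Mu] := rat_ringP b.
by apply: has_valM => //; rewrite ?unif_neq0 //; apply: rat_nu.
Qed.

Lemma rat_nu_expz b z (e : int) : z != 0 -> nu (rat_place b) (z ^ e) = nu (rat_place b) z * e.
Proof.
move=> z0; apply/rat_nuE; have [[Or Oval _] Mu] := rat_ringP b.
by apply: has_val_Xz => //; rewrite ?unif_neq0 //; apply: rat_nu.
Qed.

Lemma rat_nuX b z e : z != 0 -> nu (rat_place b) (z ^+ e) = nu (rat_place b) z * e%:Z.
Proof. by move=> z0; rewrite -rat_nu_expz. Qed.

Lemma rat_nuV b z : z != 0 -> nu (rat_place b) z^-1 = - nu (rat_place b) z.
Proof. by move=> z0; rewrite -exprN1 rat_nu_expz // mulrN1. Qed.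

Lemma rat_nu1 b : nu (rat_place b) 1 = 0.
Proof.
apply/rat_nuE; have [[Or Oval _] Mu] := rat_ringP b.
by apply: has_val_unit; apply: units1.
Qed.

Lemma rat_nu_prod b (I : Type) (r : seq I) (F : I -> E) : (forall i, F i != 0) ->
  nu (rat_place b) (\prod_(i <- r) F i) = \sum_(i <- r) nu (rat_place b) (F i).
Proof.
move=> F0; elim: r => [|i r IH]; first by rewrite !big_nil rat_nu1.
rewrite !big_cons rat_nuM ?IH //; elim: r {IH} => [|j r IH]; rewrite ?big_nil ?oner_eq0 //.
by rewrite big_cons mulf_neq0.
Qed.

Lemma rat_nu_ring b z : z != 0 -> (rat_ring b z <-> 0 <= nu (rat_place b) z).
Proof.
move=> z0; have [[Or Oval _] Mu] := rat_ringP b.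
exact: (has_val_ringP Or Oval Mu (unif_neq0 b) (rat_nu b z0)).
Qed.

Lemma rat_nu_unif c b : nu (rat_place b) (unif (Some c)) =
  if b is Some c' then (c == c')%:Z else -1.
Proof.
apply/rat_nuE; have [Ov Mu] := rat_ringP b; have [Or Oval _] := Ov.
case: b Ov Mu Or Oval => [c'|] Ov Mu Or Oval.
  have [->|cc'] := eqVneq c c'; first by apply: has_val_t.
  apply: has_val_unit; apply: (unit_of_residue Ov _ (poly_res_Some ('X - c%:P) Ov Mu)).
  by rewrite !hornerE subr_eq0 eq_sym.
have := poly_val_None Ov Mu (negbT (polyXsubC_eq0 c)); by rewrite size_XsubC.
Qed.

Lemma rat_ring_X b : rat_ring b X <-> b <> None.
Proof.
have [Ov Mu] := rat_ringP b; have [Or Oval _] := Ov.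
case: b Ov Mu Or Oval => [c|] Ov Mu Or Oval.
  by split=> // _; apply: (unif_Some_X Ov (proj1 Mu)).
split=> // /=; case/(nonunitsE Or Oval): Mu => [/eqP|]; rewrite ?(negPf (unif_neq0 None)) //.
by rewrite /= invrK.
Qed.

Lemma rat_place_inj : injective rat_place.
Proof.
move=> b b' bb'; have {bb'} rr : rat_ring b = rat_ring b'.
  have [[Or Oval _] _] := rat_ringP b; have [[Or' Oval' _] _] := rat_ringP b'.
  by rewrite -(val_ring_nonunits Or Oval) -(val_ring_nonunits Or' Oval') -!/(rat_place _) bb'.
have nn c c' : rat_ring (Some c) = rat_ring (Some c') -> c = c'.
  move=> rr'; apply/eqP; have := rat_nu_unif c (Some c').
  by rewrite /rat_place -rr' -/(rat_place _) rat_nu_unif eqxx; case: eqP.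
have XN : ~ rat_ring None X by move/rat_ring_X.
have XS c : rat_ring (Some c) X by apply/rat_ring_X.
case: b b' rr => [c|] [c'|] rr //; first by rewrite (nn _ _ rr).
  by case: XN; rewrite -rr.
by case: XN; rewrite rr.
Qed.

(** If [X] is not in [O], then [X^-1] is a nonunit and [O] is the ring at infinity; if some [X - c]
    is a nonunit, [O] is the ring at [c]. *)
Lemma nonrational_units O : vringE O -> (forall b, O <> rat_ring b) ->
  forall c, ring_units O (unif (Some c)).
Proof.
move=> Ov nO c; have [Or Oval Oc] := Ov.
have OX : O X.
  apply: contrapT => OX; apply: (nO None); apply: rat_ring_uniq => //.
  by apply/nonunitsE => //; right; rewrite /= invrK.
apply: contrapT => nU; apply: (nO (Some c)); apply: rat_ring_uniq => //.
by split=> //; apply: vring_poly.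
Qed.

End RationalFunctions.

(** * Divisors of rational functions *)

(** No uniformizer is assumed, since this serves at places not known to be discrete: without a prime
    element the default value 0 is the right one. *)
Lemma nu_unit (L : fieldType) (O : set L) u :
  is_subring O -> (forall z, O z \/ O z^-1) -> ring_units O u -> nu (nonunits O) u = 0.
Proof.
move=> Or Oval Uu; rewrite /nu; case: xgetP => [n _ [t [v []]]|//].
rewrite val_ring_nonunits // => pt Uv uE.
(* When [O] is the whole field, 0 is a prime element; [0 ^ n * v] is nonzero only for [n = 0]. *)
have [t0|t0] := eqVneq t 0.
  apply/eqP; move: uE; rewrite t0 exp0rz; case: eqP => // _ uE.
  by case: Uu => /eqP; rewrite uE mul0r.
have Mt : nonunits O t.
  rewrite pt val_ring_nonunits //; exists 1; rewrite ?mulr1 //; exact: subring1.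
have hu : has_val O t u n by exists v.
exact: (has_val_uniq Or Oval Mt t0 hu (has_val_unit t Uu)).
Qed.

Arguments unif : simpl never.

Section Divisors.
Variables (K : finFieldType) (E : fieldType) (tf : {rmorphism {poly K} -> E}).
Hypotheses (tf_inj : injective tf)
  (tf_frac : forall z, exists p q : {poly K}, [/\ q != 0, coprimep p q & z = tf p / tf q]).
Implicit Types (O : set E) (a z : E).
Notation vringE := (is_vring (rat_cst tf)).
Notation nub b := (nu (rat_place tf b)).
Notation pi c := (unif tf (Some c)).

(* O = E is not excluded. *)
Definition nonrational O : Prop := vringE O /\ forall b, O <> rat_ring tf b.

Lemma big_optionE (F : option K -> int) : \sum_b F b = F None + \sum_c F (Some c).
Proof.
rewrite (bigD1 None) //=; congr (_ + _).
rewrite (reindex_omap Some id) /=; last by case.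
by apply: eq_bigl => c; rewrite eqxx.
Qed.

(** Since [K] is finite, one product prescribes the orders at all finite rational places. Each
    [pi c] has a simple pole at infinity, which forces the order there. *)
Lemma pi_prod (e : K -> int) (a := \prod_c pi c ^ e c) :
  [/\ a != 0, forall c, nub (Some c) a = e c, nub None a = - \sum_c e c
    & forall O, nonrational O -> ring_units O a].
Proof.
have pe0 c : pi c ^ e c != 0 by rewrite expfz_neq0 // unif_neq0.
have nuE b : nub b a = \sum_c nub b (pi c ^ e c) by rewrite rat_nu_prod.
split.
- by apply/prodf_neq0 => c _.
- move=> c; rewrite nuE (bigD1 c) //= rat_nu_expz ?unif_neq0 // rat_nu_unif // eqxx mul1r.
  rewrite big1 ?addr0 // => c' /negPf cc'.
  by rewrite rat_nu_expz ?unif_neq0 // rat_nu_unif // cc' mul0r.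
- rewrite nuE -sumrN; apply: eq_bigr => c _.
  by rewrite rat_nu_expz ?unif_neq0 // rat_nu_unif // mulN1r.
- move=> O [Ov nO]; have [Or Oval _] := Ov.
  apply: (big_ind (ring_units O)) => [|u v|c _]; [exact: units1|exact: unitsM|].
  by apply: unitsXz => //; apply: nonrational_units.
Qed.

(* The degree of a principal divisor is 0, and the nonrational places
   contribute a nonnegative amount to it. *)
Lemma degree_le0 a : a != 0 -> (forall O, nonrational O -> O a) ->
  \sum_b nub b a <= 0.
Proof.
move=> a0 Oa; rewrite big_optionE.
(* [d] cancels the orders of [a] at the finite rational places, so [a * d] is integral wherever [X]
   is, and its order at infinity is the sum to be bounded. *)
have [d0 dS dN dU] := pi_prod (fun c => - nub (Some c) a).
set d := \prod_c _ in d0 dS dN dU.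
have nuad b : nub b (a * d) = nub b a + nub b d by rewrite rat_nuM.
have Oad O : vringE O -> O (tf 'X) -> O (a * d).
  move=> Ov OX; have [Or _ _] := Ov.
  have [[b OE]|nO] := pselect (exists b, O = rat_ring tf b); last first.
    have nrO : nonrational O by split=> // b OE; apply: nO; exists b.
    by apply: subringM => //; [exact: Oa | case: (dU _ nrO)].
  rewrite OE; apply/rat_nu_ring; rewrite ?mulf_neq0 //.
  case: b OE => [c|] OE; first by rewrite nuad dS subrr.
  by move: OX; rewrite OE => /rat_ring_X; case.
have <- : nub None (a * d) = nub None a + \sum_c nub (Some c) a.
  by rewrite nuad dN sumrN opprK.
have ad0 : a * d != 0 by rewrite mulf_neq0.
have [p [q [q0 pq adE]]] := tf_frac (a * d).
(* A nonconstant denominator [q] has no inverse in some valuation ring containing [X], yet by Bezout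
   [1 / q = u (p / q) + v] is integral there. Hence [a * d] is a polynomial, and its order at
   infinity is minus its degree. *)
have sq : (size q <= 1)%N.
  rewrite leqNgt; apply/negP => /(vring_poly_nonunit tf_inj) [O [Ov OX Oq]].
  apply: Oq; have [Or _ Oc] := Ov.
  have [[u v] /= uv] := Bezout_eq1_coprimepP _ _ pq.
  have tq0 : tf q != 0 by rewrite tf_eq0.
  have -> : (tf q)^-1 = tf u * (a * d) + tf v.
    apply: (mulIf tq0); rewrite mulVf // mulrDl adE -mulrA divfK // -!rmorphM -rmorphD uv.
    by rewrite rmorph1.
  apply: subringD => //; last exact: vring_poly.
  by apply: subringM => //; [exact: vring_poly | exact: Oad].
have tp0 : tf p != 0 by apply: contra_neq ad0 => tp0; rewrite adE tp0 mul0r.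
have qE : tf q = rat_cst tf q`_0 by rewrite (size1_polyC sq) coefC.
have [Ov Mu] := rat_ringP tf_inj None; have [Or Oval _] := Ov.
have tq0 : tf q != 0 by rewrite tf_eq0.
rewrite adE rat_nuM ?invr_eq0 // rat_nuV //.
have -> : nub None (tf q) = 0.
  rewrite qE; apply: nu_unit => //; apply: (units_const Ov).
  by apply: contra_neq q0 => q00; rewrite (size1_polyC sq) q00.
rewrite subr0 (rat_nuE tf_inj tf_frac (poly_val_None tf_inj Ov Mu _)) ?oppr_le0 //.
by rewrite -(tf_eq0 tf_inj).
Qed.

(** Raising the order at the free place [b0] by [- \sum_b e b] brings the degree to 0, and then
    [pi_prod] applies. *)
Lemma exists_divisor (T : pred (option K)) (e : option K -> int) :
  (exists b, ~~ T b) -> \sum_b e b <= 0 ->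
  exists a, [/\ a != 0, forall b, T b -> nub b a = e b, forall b, e b <= nub b a
              & forall O, nonrational O -> O a].
Proof.
move=> [b0 Tb0] se.
pose e' b := e b - (if b == b0 then \sum_b e b else 0).
have [a0 aS aN aU] := pi_prod (fun c => e' (Some c)).
set a := \prod_c _ in a0 aS aN aU.
have se' : \sum_b e' b = 0.
  by rewrite /e' sumrB -[X in _ - X]big_mkcond big_pred1_eq subrr.
have aE b : nub b a = e' b.
  case: b => [c|]; first exact: aS.
  by rewrite aN; move/eqP: se'; rewrite big_optionE addr_eq0 => /eqP.
exists a; split=> //.
- move=> b Tb; rewrite aE /e'; case: eqP => [bb|]; last by rewrite subr0.
  by move: Tb0; rewrite -bb Tb.
- by move=> b; rewrite aE /e'; case: eqP => _; lia.
- by move=> O /aU [].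
Qed.

Lemma split_poly_units (s : seq K) (f : {poly K}) O :
  f %= \prod_(a <- s) ('X - a%:P) -> nonrational O -> ring_units O (tf f).
Proof.
move=> /eqpP [[c d] /= /andP[c0 d0] fE] [Ov nO]; have [Or Oval Oc] := Ov.
have -> : tf f = rat_cst tf (c^-1 * d) * tf (\prod_(a <- s) ('X - a%:P)).
  rewrite -[f]scale1r -(mulVf c0) -scalerA fE scalerA -mul_polyC rmorphM //.
apply: unitsM => //.
  by apply: (units_const Ov); rewrite mulf_neq0 ?invr_eq0.
rewrite rmorph_prod; apply: (big_ind (ring_units O)) => [|u v|a _]; [exact: units1|exact: unitsM|].
exact: (nonrational_units tf_inj tf_frac Ov nO).
Qed.

Lemma rational_of_nu g A : (forall O, nonrational O -> ring_units O g) ->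
  place (rat_cst tf) A -> nu A g <> 0 -> exists b, A = rat_place tf b.
Proof.
move=> Ug /placeP [O [t [Ov t0 Mt ->]]] nug; apply: contrapT => nO; apply: nug.
have [Or Oval _] := Ov; apply: nu_unit => //; apply: Ug; split=> // b OE.
by apply: nO; exists b; rewrite OE.
Qed.

End Divisors.

(** * Totally ramified places *)

Lemma digit_uniq (d i j : nat) (x y : int) : (i < d)%N -> (j < d)%N ->
  d%:Z * x + i%:Z = d%:Z * y + j%:Z -> i = j.
Proof.
move=> id jd e; have modE (l : nat) (z : int) : (l < d)%N -> ((d%:Z * z + l%:Z) %% d)%Z = l%:Z.
  by move=> ld; rewrite mulrC modzMDl modz_small // lez_nat ltz_nat ld.
by have := modE _ x id; rewrite e modE // => -[].
Qed.

Section Uniformizer.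
Variables (k E : fieldType) (iota : {rmorphism k -> E}) (F : fieldExtType E).
Variables (O : set E) (t : E).
Hypotheses (Ov : is_vring iota O) (t0 : t != 0) (Mt : nonunits O t).
Notation v := (nu (nonunits O)).
Hypothesis valO : forall z, z != 0 -> has_val O t z (v z).
Notation d := (\dim {:F}).
Notation cF := (const_ext iota F).

(** [ramification_index] speaks only of values of [nu], which may be defaults. But [nu] of [t] is
    [d], hence nonzero, and so a prime element exists at [Q]. *)
Lemma ramified_uniformizer (Q : set F) :
  place cF Q -> ramification_index Q (nonunits O) d ->
  exists O' p, [/\ is_vring cF O', Q = nonunits O', nonunits O' p, p != 0
    & prime_element Q p /\ forall z : E, z != 0 -> has_val O' p z%:A (d%:Z * v z)].
Proof.
move=> /placeP [O' [t' [Ov' t'0 Mt' ->]]] ram.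
have [Or Oval _] := Ov; have [Or' Oval' _] := Ov'.
have d0 : (0 < d)%N by rewrite adim_gt0.
have vt : v t = 1.
  by apply: (has_val_uniq Or Oval Mt t0 (valO t0)); apply: has_val_t.
have tA0 : t%:A != 0 :> F by rewrite scaler_eq0 oner_eq0 orbF.
have nut : nu (nonunits O') (t%:A : F) = d by rewrite ram // vt mulr1.
have [|p [pp hp]] := nu_neq0 (O := O') (z := t%:A) Or' Oval'.
  by rewrite nut; lia.
have p0 : p != 0.
  apply/eqP => p0; move: hp; rewrite p0 nut => -[u _]; rewrite exp0rz.
  case: eqP => [|_ /eqP]; first by lia.
  by rewrite mul0r (negPf tA0).
exists O', p; split=> //; first exact: prime_element_nonunit.
split=> // z z0.
have hz w : w != 0 -> v w != 0 -> has_val O' p (w%:A : F) (d%:Z * v w).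
  move=> w0 vw; have nw : nu (nonunits O') (w%:A : F) != 0.
    by rewrite ram // mulf_neq0 //; lia.
  have [p' [pp' hp']] := nu_neq0 Or' Oval' nw.
  by rewrite -ram //; apply: has_val_prime pp' hp'.
(* A value 0 could be the default, so [z] is written as [(t * z) / t], a quotient of elements of
   nonzero order. *)
have [vz|vz] := eqVneq (v z) 0; last exact: hz.
have zt0 : t * z != 0 by rewrite mulf_neq0.
have vzt : v (t * z) = 1.
  apply: (has_val_uniq Or Oval Mt t0 (valO zt0)).
  by rewrite -[1]addr0; apply: has_valM => //; [exact: has_val_t | rewrite -vz; apply: valO].
have -> : z%:A = (t * z)%:A / t%:A :> F.
  by apply: (mulIf tA0); rewrite divfK // mulr_algl scalerA mulrC.
have -> : d%:Z * v z = d%:Z * v (t * z) + - (d%:Z * v t) by rewrite vz vzt vt; ring.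
apply: has_valM => //; first by apply: hz; rewrite ?vzt.
by apply: has_valV => //; apply: hz; rewrite ?vt.
Qed.

End Uniformizer.

Section Expansion.
Variables (k E : fieldType) (iota : {rmorphism k -> E}) (F : fieldExtType E).
Variables (O : set E) (O' : set F) (p : F).
Notation v := (nu (nonunits O)).
Notation d := (\dim {:F}).
Notation cF := (const_ext iota F).
Hypotheses (Ov' : is_vring cF O') (Mp : nonunits O' p) (p0 : p != 0).
Hypothesis hvA : forall z : E, z != 0 -> has_val O' p z%:A (d%:Z * v z).

Let Or' : is_subring O'. Proof. by case: Ov'. Qed.
Let Oval' : forall z, O' z \/ O' z^-1. Proof. by case: Ov'. Qed.

Lemma ramified_comb (a : 'I_d -> E) : (exists j, a j != 0) ->
  exists j0, [/\ a j0 != 0, has_val O' p (\sum_j a j *: p ^+ j) (d%:Z * v (a j0) + j0%:Z)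
    & forall j, a j != 0 -> d%:Z * v (a j0) + j0%:Z <= d%:Z * v (a j) + j%:Z].
Proof.
move=> [j1 aj1].
have nz j : (a j *: p ^+ j != 0) = (a j != 0).
  by rewrite scaler_eq0 negb_or expf_neq0 // andbT.
have [| | |j0 [aj0 h0 min0]] := @has_val_sum _ O' Or' Oval' p Mp p0 _
    (fun j : 'I_d => a j *: p ^+ j) (fun j => d%:Z * v (a j) + j%:Z).
- move=> j; rewrite nz => aj; rewrite -[a j *: _]mulr_algl.
  by apply: has_valM => //; [exact: hvA | exact: (has_valXz Or' p j%:Z)].
- move=> i j _ _ eqij; apply: val_inj => /=.
  exact: digit_uniq eqij.
- by exists j1; rewrite nz.
by exists j0; split=> // [|j aj]; rewrite -?nz //; apply: min0; rewrite nz.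
Qed.

Lemma ramified_expand (z : F) : exists a : 'I_d -> E, z = \sum_j a j *: p ^+ j.
Proof.
pose X := [tuple p ^+ j | j < d].
have XE (i : 'I_d) : X`_i = p ^+ i by rewrite -tnth_nth tnth_mktuple.
have fX : free X.
  apply/freeP => a sa0 i; apply/eqP; apply: contraT => ai.
  have [|j0 [_ hj _]] := @ramified_comb a; first by exists i.
  have := has_val_neq0 p0 hj.
  have -> : \sum_j a j *: p ^+ j = \sum_(j < d) a j *: X`_j.
    by apply: eq_bigr => j _; rewrite XE.
  by rewrite sa0 eqxx.
have bX : basis_of {:F} X by rewrite basisEfree fX subvf size_tuple leqnn.
exists (fun j => coord X j z); rewrite {1}(coord_basis bX (memvf z)).
by apply: eq_bigr => j _; rewrite XE.
Qed.

Lemma ramified_val (z : F) : z != 0 -> exists s, has_val O' p z s.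
Proof.
have [a ->] := ramified_expand z => nz.
have [|j0 [_ h0 _]] := @ramified_comb a; last by eexists; exact: h0.
apply: contrapT => na; move/eqP: nz; apply; apply: big1 => j _.
have [->|aj] := eqVneq (a j) 0; first by rewrite scale0r.
by case: na; exists j.
Qed.

(* a is the constant coefficient of the expansion of u in powers of p. *)
Lemma ramified_approx (u : F) : has_val O' p u 0 ->
  exists a : E, [/\ a != 0, v a = 0
    & u = a%:A \/ exists s, [/\ has_val O' p (u - a%:A) s, 0 < s & ~~ (d%:Z %| s)%Z]].
Proof.
have d0 : (0 < d)%N by rewrite adim_gt0.
have [a uE] := ramified_expand u => hu.
have [|j0 [aj0 h0 min0]] := @ramified_comb a.
  apply: contrapT => na; have := has_val_neq0 p0 hu; rewrite uE big1 ?eqxx // => j _.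
  have [->|aj] := eqVneq (a j) 0; first by rewrite scale0r.
  by case: na; exists j.
rewrite -uE in h0; have s0 := has_val_uniq Or' Oval' Mp p0 h0 hu.
have j00 : j0 = 0%N :> nat.
  by apply: (digit_uniq (ltn_ord j0) d0 (x := v (a j0)) (y := 0)); rewrite mulr0 add0r s0.
have vj0 : v (a j0) = 0.
  by move/eqP: s0; rewrite j00 addr0 mulf_eq0 => /orP [/eqP|/eqP //]; lia.
exists (a j0); split=> //.
(* Without the constant term the exponents left are [d * v (a j) + j] with [0 < j < d], none
   divisible by [d]. *)
pose b j := if j == j0 then 0 else a j.
have ubE : u - (a j0)%:A = \sum_j b j *: p ^+ j.
  rewrite uE (bigD1 j0) //= j00 expr0 addrAC subrr add0r [RHS](bigD1 j0) //= {1}/b eqxx scale0r add0r.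
  by apply: eq_bigr => j /negPf jj0; rewrite /b jj0.
have [[j1 bj1]|nb] := pselect (exists j, b j != 0); last first.
  left; apply/eqP; rewrite -subr_eq0 ubE big1 // => j _.
  have [->|bj] := eqVneq (b j) 0; first by rewrite scale0r.
  by case: nb; exists j.
right; have [|j2 [bj2 h2 _]] := @ramified_comb b; first by exists j1.
rewrite -ubE in h2; move: bj2 h2; rewrite /b; have [_|/eqP jj] := eqVneq j2 j0; first by rewrite eqxx.
move=> aj2 h2; exists (d%:Z * v (a j2) + j2%:Z); split=> //.
  have := min0 _ aj2; rewrite vj0 j00 mulr0 addr0 le_eqVlt => /orP [/eqP e0|//].
  case: jj; apply: val_inj; apply/esym.
  by apply: (digit_uniq (ltn_ord j0) (ltn_ord j2) (x := 0) (y := v (a j2))); rewrite -e0 j00 mulr0.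
apply/negP => /dvdzP [q qE]; case: jj; apply: val_inj; rewrite /= j00.
apply: (digit_uniq (ltn_ord j2) d0 (x := v (a j2)) (y := q)).
by rewrite addr0 qE mulrC.
Qed.

End Expansion.

(** * Splitting fields, norms and simple extensions *)

Lemma irreducible_factor (F : fieldType) (p : {poly F}) : (1 < size p)%N ->
  exists2 q : {poly F}, irreducible_poly q & q %| p.
Proof.
have [n] := ubnP (size p); elim: n p => // n IH p le_pn sp.
have [pI|pI] := pselect (irreducible_poly p); first by exists p.
have [q [q1 qp nqp]] : exists q : {poly F}, [/\ size q != 1%N, q %| p & ~~ (q %= p)].
  apply: contrapT => nq; apply: pI; split=> // q q1 qp; apply: contraT => nqp.
  by case: nq; exists q.
have p0 : p != 0 by rewrite -size_poly_gt0 ltnW.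
have q0 : q != 0 by apply: contraNneq p0 => q0; rewrite q0 dvd0p in qp.
have sqp : (size q < size p)%N.
  by rewrite ltn_neqAle dvdp_leq // andbT; apply: contra nqp => /eqP e; rewrite -dvdp_size_eqp // e.
have [||q' q'I q'q] := IH q; first by apply: leq_trans sqp _.
  by rewrite ltn_neqAle eq_sym q1 size_poly_gt0.
by exists q' => //; apply: dvdp_trans qp.
Qed.

Lemma splitting_field_ex n (F : fieldType) (p : {poly F}) : (size p <= n.+1)%N -> p != 0 ->
  exists (L : fieldType) (phi : {rmorphism F -> L}) (s : seq L),
    map_poly phi p %= \prod_(a <- s) ('X - a%:P).
Proof.
elim: n F p => [|n IH] F p sp p0.
  exists F, idfun, [::]; rewrite big_nil map_poly_id // -size_poly_eq1.
  by rewrite eqn_leq sp size_poly_gt0.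
have [le1|sp1] := leqP (size p) 1; first by apply: IH => //; apply: leq_trans le1 _.
have [q /irredp_FAdjoin [L1 _ [z qz _]] qp] := irreducible_factor sp1.
pose phi1 : {rmorphism F -> L1} := in_alg L1.
have /factor_theorem [p1 p1E] : root (map_poly phi1 p) z.
  by rewrite -dvdp_XsubCl; apply: dvdp_trans (_ : map_poly phi1 q %| _); rewrite ?dvdp_map // dvdp_XsubCl.
have fp0 : map_poly phi1 p != 0 by rewrite map_poly_eq0.
have p10 : p1 != 0 by apply: contraNneq fp0 => p10; rewrite p1E p10 mul0r.
have sp1E : (size p1).+1 = size p.
  by rewrite -(size_map_poly phi1 p) p1E size_Mmonic ?monicXsubC // size_XsubC addn2.
have [|L [phi [s sE]]] := IH _ p1 _ p10; first by rewrite -ltnS sp1E.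
exists L, (phi \o phi1), (phi z :: s).
rewrite map_poly_comp p1E rmorphM /= map_polyXsubC big_cons mulrC.
by apply: eqp_mull.
Qed.

(** As [m] is nonzero in [F], [X^m - 1] is separable and acquires [m] distinct roots; a finite group
    of roots of unity is cyclic. *)
Lemma primitive_root_ex m (F : fieldType) : (0 < m)%N -> m%:R != 0 :> F ->
  exists (L : fieldType) (phi : {rmorphism F -> L}) (zeta : L), m.-primitive_root zeta.
Proof.
move=> m0 mF; have sX : size ('X^m - 1 : {poly F}) = m.+1 by rewrite size_XnsubC.
have [||L [phi [s]]] := @splitting_field_ex m F ('X^m - 1); first by rewrite sX.
  by rewrite -size_poly_eq0 sX.
rewrite rmorphB rmorph1 rmorphXn /= map_polyX => sE.
have mL : m%:R != 0 :> L by rewrite -(rmorph_nat phi) fmorph_eq0.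
exists L, phi; have : has m.-primitive_root s; last by case/hasP => z _ zp; exists z.
apply: has_prim_root => //.
- apply/allP => a sa; rewrite /root_of_unity -/(root _ a) (eqp_root sE).
  by rewrite root_prod_XsubC.
- by rewrite -separable_prod_XsubC -(eqp_separable sE) separable_Xn_sub_1.
- by have := eqp_size sE; rewrite size_XnsubC // size_prod_XsubC => -[->].
Qed.

Section FieldNorm.
Import VectorInternalTheory.
Variables (E : fieldType) (F : fieldExtType E).

(** [N] is the determinant of multiplication by [y], a map whose m-th power is the scalar [g]. *)
Lemma exists_norm (y : F) (g : E) m : y ^+ m = g%:A -> exists N : E, N ^+ m = g ^+ \dim {:F}.
Proof.
move=> yE; have -> : \dim {:F} = dim F by rewrite dimvf.
pose A : 'M[E]_(dim F) := \matrix_i v2r (y * r2v (delta_mx 0 i)).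
have AE (u : 'rV_(dim F)) : u *m A = v2r (y * r2v u).
  rewrite {2}[u]row_sum_delta linear_sum mulr_sumr linear_sum mulmx_sum_row.
  by apply: eq_bigr => i _; rewrite rowK !linearZ /= -scalerAr linearZ.
have AX k (u : 'rV_(dim F)) : u *m iter k (mulmx A) 1%:M = v2r (y ^+ k * r2v u).
  elim: k u => [|k IH] u; first by rewrite /= mulmx1 expr0 mul1r r2vK.
  by rewrite /= mulmxA IH AE v2rK mulrA -exprSr.
have Am : iter m (mulmx A) 1%:M = g%:M.
  apply/row_matrixP => i; rewrite !rowE AX yE mulr_algl linearZ /= r2vK.
  by rewrite mul_mx_scalar.
exists (\det A); rewrite -[RHS]det_scalar -Am.
by elim: m {yE Am} => [|m IH]; rewrite ?expr0 ?det1 // exprS IH det_mulmx.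
Qed.

End FieldNorm.

Section SimpleExtension.
Variables (E : fieldType) (F : fieldExtType E) (y : F).
Hypothesis F_gen : <<1; y>>%VS = {:F}%VS.
Notation d := (\dim {:F}).
Notation "p ^%:A" := (map_poly (in_alg F) p).

Lemma adjoin_degree_gen : adjoin_degree 1 y = d.
Proof. by rewrite adjoin_degreeE F_gen dimv1 divn1. Qed.

Lemma gen_indep (p : {poly E}) : (size p <= d)%N -> p^%:A.[y] = 0 -> p = 0.
Proof.
move=> sp py; apply/eqP; rewrite -(map_poly_eq0 (in_alg F)); apply: contraT => p0.
have : minPoly 1 y %| p^%:A.
  by apply: minPoly_dvdp; [apply/polyOver1P; exists p | apply/rootP].
move=> /(dvdp_leq p0); rewrite size_minPoly size_map_poly adjoin_degree_gen.
by move=> /leq_trans/(_ sp); rewrite ltnn.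
Qed.

Lemma gen_span (z : F) : exists2 p : {poly E}, (size p <= d)%N & z = p^%:A.[y].
Proof.
have /polyOver1P [p pE] := Fadjoin_polyOver 1 y z.
exists p; last by rewrite -pE Fadjoin_poly_eq // F_gen memvf.
by rewrite -(size_map_poly (in_alg F)) -pE -adjoin_degree_gen size_Fadjoin_poly.
Qed.

End SimpleExtension.

(** * Degree and ramification of the cover *)

Lemma subring_nat (L : fieldType) (O : set L) k : is_subring O -> O k%:R.
Proof.
move=> Or; elim: k => [|k IH]; first exact: subring0.
by rewrite -natr1; apply: subringD => //; apply: subring1.
Qed.

Lemma exprD_taylor (L : fieldType) (O : set L) (a v : L) e : is_subring O -> O a -> O v ->
  exists2 r, O r & (a + v) ^+ e.+1 = a ^+ e.+1 + e.+1%:R * a ^+ e * v + v ^+ 2 * r.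
Proof.
move=> Or Oa Ow; elim: e => [|e [r Orr IH]].
  exists 0; first exact: subring0.
  by rewrite !expr1 expr0 mulr0 addr0 mulr1 mul1r.
exists (a * r + e.+1%:R * a ^+ e + v * r).
  do ?[apply: subringD => // | apply: subringM => //]; last exact: subringX.
  exact: subring_nat.
by rewrite exprS IH -[e.+2%:R]natr1 !(exprS a); ring.
Qed.

Lemma algM (E : fieldType) (F : fieldExtType E) (a b : E) : (a * b)%:A = a%:A * b%:A :> F.
Proof. exact: (rmorphM (in_alg F)). Qed.

Lemma algX (E : fieldType) (F : fieldExtType E) (a : E) k : (a ^+ k)%:A = a%:A ^+ k :> F.
Proof. exact: (rmorphXn (in_alg F)). Qed.

Lemma algV (E : fieldType) (F : fieldExtType E) (a : E) : (a^-1)%:A = (a%:A)^-1 :> F.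
Proof. exact: (fmorphV (in_alg F)). Qed.

Section Cover.
Variables (K : finFieldType) (E : fieldType) (tf : {rmorphism {poly K} -> E}).
Hypotheses (tf_inj : injective tf)
  (tf_frac : forall z, exists p q : {poly K}, [/\ q != 0, coprimep p q & z = tf p / tf q]).
Variables (F : fieldExtType E) (m : nat) (f : {poly K}) (s : seq K) (y : F).
Hypotheses (m_gt1 : (1 < m)%N) (mK : m%:R != 0 :> K) (f0 : f != 0)
  (fs : f %= \prod_(a <- s) ('X - a%:P))
  (f_not_power : forall d : nat, (1 < d)%N -> (d %| m)%N -> ~ exists g : E, tf f = g ^+ d)
  (yE : y ^+ m = (tf f)%:A) (F_gen : <<1; y>>%VS = {:F}%VS).
Notation d := (\dim {:F}).
Notation cF := (const_ext (rat_cst tf) F).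
Notation nub b := (nu (rat_place tf b)).

Lemma tf_f_neq0 : tf f != 0. Proof. by rewrite tf_eq0. Qed.

Lemma gen_neq0 : y != 0.
Proof.
apply: contraTneq (tf_f_neq0) => y0; move/eqP: yE; rewrite y0 expr0n -leqn0 leqNgt (ltnW m_gt1) /=.
by rewrite eq_sym scaler_eq0 oner_eq0 orbF => /eqP ->; rewrite eqxx.
Qed.

Lemma gen_exp_notin_base k (a : E) : (0 < k < d)%N -> y ^+ k <> a%:A.
Proof.
move=> /andP[k0 kd] ya; have := @gen_indep _ _ _ F_gen ('X^k - a%:P).
rewrite size_XnsubC // rmorphB /= map_polyXn map_polyC /= !hornerE ya subrr.
move=> /(_ kd erefl) /eqP; rewrite -size_poly_eq0 size_XnsubC //.
Qed.

Lemma dim_le : (d <= m)%N.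
Proof.
rewrite leqNgt; apply/negP => md; apply: (@gen_exp_notin_base m (tf f)) => //.
by rewrite md ltnW.
Qed.

Lemma split_const : exists2 c : K, c != 0 & f = c *: \prod_(a <- s) ('X - a%:P).
Proof.
move: fs => /eqpP [[c c'] /= /andP[c0 c'0] fE]; exists (c^-1 * c').
  by rewrite mulf_neq0 ?invr_eq0.
by rewrite -[f]scale1r -(mulVf c0) -scalerA fE scalerA.
Qed.

Lemma nu_split (c : K) : nub (Some c) (tf f) = count_mem c s.
Proof.
have [c0 c00 ->] := split_const.
have [[Or Oval _] _] := rat_ringP tf_inj (Some c).
have [Ov _] := rat_ringP tf_inj (Some c).
rewrite -mul_polyC rmorphM rmorph_prod /= rat_nuM //; last 2 first.
- by rewrite tf_eq0 // polyC_eq0.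
- by rewrite prodf_seq_neq0; apply/allP => a _; rewrite /= tf_eq0 // polyXsubC_eq0.
rewrite (nu_unit Or Oval (units_const Ov c00)) add0r rat_nu_prod //; last first.
  by move=> a; rewrite tf_eq0 // polyXsubC_eq0.
elim: s => [|a s' IH]; rewrite ?big_nil // big_cons IH /=.
by rewrite -[tf _]/(unif tf (Some a)) rat_nu_unif // PoszD.
Qed.

Section OnePlace.
Variables (b : option K) (O' : set F) (p : F).
Hypotheses (Ov' : is_vring cF O') (Mp : nonunits O' p) (p0 : p != 0).
Hypothesis hvA : forall z : E, z != 0 -> has_val O' p z%:A (d%:Z * nub b z).

Let O := rat_ring tf b.
Let t := unif tf b.
Let Ov : is_vring (rat_cst tf) O. Proof. by case: (rat_ringP tf_inj b). Qed.
Let Mt : nonunits O t. Proof. by case: (rat_ringP tf_inj b). Qed.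
Let t0 : t != 0. Proof. exact: unif_neq0. Qed.
Let Or : is_subring O. Proof. by case: Ov. Qed.
Let Oval : forall z, O z \/ O z^-1. Proof. by case: Ov. Qed.
Let Or' : is_subring O'. Proof. by case: Ov'. Qed.
Let Oval' : forall z, O' z \/ O' z^-1. Proof. by case: Ov'. Qed.
Let valO z : z != 0 -> has_val O t z (nub b z). Proof. exact: rat_nu. Qed.

Lemma ramified_nonunit (z : E) : nonunits O z -> nonunits O' z%:A.
Proof.
have [->|z0 Mz] := eqVneq z 0; first by rewrite scale0r => _; apply: nonunits0.
apply: (has_val_nonunit Or' Oval' Mp (hvA z0)).
have /(has_val_nonunitP Or Oval Mt t0 (valO z0)) := Mz.
by move=> v0; rewrite mulr_gt0 // ltz_nat adim_gt0.
Qed.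

Lemma unit_val0 (z : F) : has_val O' p z 0 -> ring_units O' z.
Proof. by move=> [u Uu ->]; rewrite expr0z mul1r. Qed.

Lemma root_val0 (w : F) (u : E) e : (0 < e)%N -> w ^+ e = u%:A -> u != 0 -> nub b u = 0 ->
  has_val O' p w 0.
Proof.
move=> e0 wE u0 vu.
have w0 : w != 0.
  apply: contra_neq u0 => w0; move/eqP: wE; rewrite w0 expr0n -leqn0 leqNgt e0 /=.
  by rewrite eq_sym scaler_eq0 oner_eq0 orbF => /eqP.
have [s1 hs1] := ramified_val Ov' Mp p0 hvA w0.
have := has_val_uniq Or' Oval' Mp p0 (has_valX Or' e hs1).
rewrite wE => /(_ _ (hvA u0)); rewrite vu mulr0.
by move=> /eqP; rewrite mulf_eq0 eqz_nat eqn0Ngt e0 orbF => /eqP <-.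
Qed.

(* The norm N of y satisfies N ^ m = f ^ d, so m' = m / gcd(m, d) divides all
   multiplicities of f and f = c h ^ m'. The residue at the ramified place of
   w = y ^ gcd(m, d) / h, an m'-th root of c, then makes f an m'-th power. *)
Lemma cover_dim : d = m.
Proof.
apply/eqP; rewrite eqn_leq dim_le leqNgt; apply/negP => dm.
have d0 : (0 < d)%N by rewrite adim_gt0.
have [N NE] := exists_norm yE.
pose e := gcdn m d; pose m' := (m %/ e)%N.
have e0 : (0 < e)%N by rewrite gcdn_gt0 d0 orbT.
have mE : m = (m' * e)%N by rewrite divnK // dvdn_gcdl.
have dE : d = (d %/ e * e)%N by rewrite divnK // dvdn_gcdr.
have le_ed : (e <= d)%N by rewrite dvdn_leq // dvdn_gcdr.
have m'1 : (1 < m')%N.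
  rewrite ltnNge; apply/negP => m'1; have : (m <= e)%N by rewrite mE -[leqRHS]mul1n leq_mul2r m'1 orbT.
  by move=> /leq_trans/(_ le_ed); rewrite leqNgt dm.
have cop : coprime m' (d %/ e) by rewrite /coprime -(eqn_pmul2r e0) muln_gcdl -mE -dE mul1n.
have N0 : N != 0.
  apply: contraTneq (tf_f_neq0) => N0; move/eqP: NE; rewrite N0 expr0n -leqn0 leqNgt (ltnW m_gt1) /=.
  by rewrite eq_sym expf_eq0 d0 => /eqP ->; rewrite eqxx.
have divc c : (m' %| count_mem c s)%N.
  have := congr1 (nub (Some c)) NE; rewrite !rat_nuX ?tf_f_neq0 // nu_split => vE.
  have : (m %| count_mem c s * d)%N.
    rewrite -[(m %| _)%N]/(m%:Z %| (count_mem c s * d)%:Z)%Z PoszM -vE.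
    exact: dvdz_mull.
  have -> : (count_mem c s * d = count_mem c s * (d %/ e) * e)%N by rewrite -mulnA -dE.
  by rewrite [in X in X -> _]mE dvdn_pmul2r // Gauss_dvdl.
have [c c0 fE] := split_const.
pose h := \prod_(a <- undup s) ('X - a%:P) ^+ (count_mem a s %/ m').
have {}fE : f = c *: h ^+ m'.
  rewrite fE; congr (_ *: _); rewrite -prodr_undup_exp_count /h -prodrXl.
  by apply: eq_bigr => a _; rewrite -exprM divnK.
have h0 : tf h != 0.
  by rewrite tf_eq0 //; apply: contraNneq f0 => h0; rewrite fE h0 expr0n -leqn0 leqNgt (ltnW m'1) scaler0.
have tf_fE : tf f = rat_cst tf c * tf h ^+ m' by rewrite fE -mul_polyC rmorphM rmorphXn.
pose w := y ^+ e / (tf h)%:A.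
have hA0 : (tf h)%:A != 0 :> F by rewrite scaler_eq0 negb_or h0 oner_eq0.
have wE : w ^+ m' = (rat_cst tf c)%:A.
  apply: (mulIf (expf_neq0 m' hA0)); rewrite -exprMn divfK // -exprM mulnC -mE yE tf_fE.
  by rewrite algM algX.
have c00 : rat_cst tf c != 0 by rewrite fmorph_eq0.
have hw : has_val O' p w 0.
  apply: (root_val0 (ltnW m'1) wE c00).
  exact: (nu_unit Or Oval (units_const Ov c0)).
have [a [a0 va wa]] := ramified_approx Ov' Mp p0 hvA hw.
have Mwa : nonunits O' (w - a%:A).
  case: wa => [->|[s1 [hs1 s1_gt0 _]]]; first by rewrite subrr; apply: nonunits0.
  exact: (has_val_nonunit Or' Oval' Mp hs1).
have [k Mk] := rat_residue tf_inj tf_frac a0 va.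
have Mwk : nonunits O' (w - cF k).
  have -> : w - cF k = (w - a%:A) + (a - rat_cst tf k)%:A.
    by rewrite scalerBl addrA subrK.
  by apply: nonunitsD => //; apply: ramified_nonunit.
(* [w - k] divides [w ^+ m' - k ^+ m' = c - k ^+ m']. This is a constant, and the only constant that
   is a nonunit is 0. *)
have Mc : nonunits O' (cF (c - k ^+ m')).
  have -> : cF (c - k ^+ m') = (w - cF k) * \sum_(i < m') w ^+ (m'.-1 - i) * (cF k) ^+ i.
    by rewrite -subrXX wE rmorphB rmorphXn.
  rewrite mulrC; apply: nonunitsM => //; apply: subring_sum => // i _.
  have [_ _ Oc'] := Ov'; have [_ Ow _] := unit_val0 hw.
  by apply: subringM => //; apply: subringX.
have /eqP ck : c - k ^+ m' == 0.
  by apply: contraT => ck; case: Mc => _; case; apply: (units_const Ov').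
apply: (f_not_power m'1); first by rewrite mE dvdn_mulr.
have cE : c = k ^+ m' by apply/eqP; rewrite -subr_eq0 ck.
by exists (rat_cst tf k * tf h); rewrite tf_fE cE rmorphXn exprMn.
Qed.

(* If e = gcd(m, nu f) > 1, some w outside E has w ^ e = u, with u in E a unit.
   As e is invertible, w - a and u - a ^ e have the same valuation when a in E
   approximates w; the latter is a multiple of m, the former can be chosen not
   to be. *)
Lemma cover_coprime : coprimez m (nub b (tf f)).
Proof.
have dE := cover_dim; set l := nub b (tf f).
rewrite /coprimez; set e := gcdz _ _.
have /dvdzP [m' mE] : (e %| m%:Z)%Z := dvdz_gcdl _ _.
have /dvdzP [l' lE] : (e %| l)%Z := dvdz_gcdr _ _.
have e_ge0 : 0 <= e by [].
case: e e_ge0 mE lE => // e _ mE lE.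
have : 0 <= m' by rewrite leNgt; apply/negP => m'0; move: mE m_gt1; nia.
case: m' mE => // m' mE _.
have {}mE : m = (m' * e)%N by apply/eqP; rewrite -eqz_nat PoszM mE.
apply/eqP; congr Posz; apply/eqP; apply: contraT => e1.
have e_gt1 : (1 < e)%N by case: e e1 mE {lE} => [|[|e]] // _; rewrite ?muln0 => m0; move: m_gt1; rewrite m0.
have m'0 : (0 < m')%N by case: m' mE => // m0; move: m_gt1; rewrite m0.
have m'm : (m' < m)%N by rewrite mE -[ltnLHS]muln1 ltn_pmul2l.
pose u := tf f / t ^ l; pose w := y ^+ m' / (t ^ l')%:A.
have tl0 : t ^ l != 0 by rewrite expfz_neq0.
have u0 : u != 0 by rewrite mulf_neq0 ?tf_f_neq0 ?invr_eq0.
have vu : nub b u = 0.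
  apply: rat_nuE => //; rewrite -(subrr l); apply: has_valM => //; first exact: rat_nu tf_f_neq0.
  by apply: has_valV => //; apply: has_valXz.
have tA0 : (t ^ l')%:A != 0 :> F by rewrite scaler_eq0 negb_or oner_eq0 expfz_neq0.
have wE : w ^+ e = u%:A.
  apply: (mulIf (expf_neq0 e tA0)); rewrite -exprMn divfK // -exprM -mE yE.
  by rewrite -algX -algM exprnP exprz_exp -lE divfK.
have hw : has_val O' p w 0 by apply: root_val0 wE u0 vu; apply: ltnW.
have [a [a0 va]] := ramified_approx Ov' Mp p0 hvA hw.
have ha : has_val O' p a%:A 0 by have := hvA a0; rewrite va mulr0.
(* If [w] were equal to [a], then [y ^+ m'] would lie in [E] although [0 < m' < d]. *)
case=> [wa|[s1 [hs1 s1_gt0 ndiv]]].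
  case: (@gen_exp_notin_base m' (a * t ^ l')); first by rewrite m'0 dE.
  by rewrite -mulr_algl -scalerA -[_ *: (_ *: _)]mulr_algl -wa divfK // mulr1.
set v := w - a%:A in hs1.
have Mv := has_val_nonunit Or' Oval' Mp hs1 s1_gt0.
have [aA0 OaA _] := unit_val0 ha.
have e_pred : e = e.-1.+1 by rewrite prednK // ltnW.
(* With [w = a + v], [u - a ^+ e] is [v] times [e a^(e-1) + v r], a unit because [e] is invertible
   in [K]. *)
have [r Orr rE] := exprD_taylor e.-1 Or' OaA (proj1 Mv).
have eK : e%:R != 0 :> K by apply: contra_neq mK => e0; rewrite mE natrM e0 mulr0.
have Ubr : ring_units O' (e%:R * a%:A ^+ e.-1 + v * r).
  apply: unitsDr => //; last by rewrite mulrC; apply: nonunitsM.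
  apply: unitsM => //; last by apply: unitsX => //; apply: unit_val0.
  by rewrite -(rmorph_nat cF); apply: (units_const Ov').
have uaE : (u - a ^+ e)%:A = v * (e%:R * a%:A ^+ e.-1 + v * r).
  rewrite -e_pred (addrC a%:A) /v subrK -/v in rE.
  by rewrite scalerBl -wE rE algX; ring.
have hua : has_val O' p (u - a ^+ e)%:A s1.
  by rewrite uaE -[s1]addr0; apply: has_valM => //; apply: has_val_unit.
have ua0 : u - a ^+ e != 0.
  by have := has_val_neq0 p0 hua; rewrite scaler_eq0 negb_or => /andP[].
move: ndiv; rewrite (has_val_uniq Or' Oval' Mp p0 hua (hvA ua0)).
by rewrite dvdz_mulr.
Qed.

End OnePlace.
End Cover.

(** * Components with respect to the powers of a generator *)

Section Components.
Variables (k E : fieldType) (iota : {rmorphism k -> E}) (F : fieldExtType E).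
Variables (m : nat) (y : F) (g : E).
Hypotheses (m0 : (0 < m)%N) (mk : m%:R != 0 :> k).
Hypotheses (yE : y ^+ m = g%:A) (F_gen : <<1; y>>%VS = {:F}%VS) (dE : \dim {:F} = m).
Notation cF := (const_ext iota F).
Notation "p ^%:A" := (map_poly (in_alg F) p).

Definition restriction (O1 : set F) : set E := [set e | O1 e%:A].

(** Chevalley's theorem over the image of [O], forbidding the inverses of its nonzero nonunits, so
    that [B] restricts exactly to [O]. Of two nonunits one divides the other in [O], which gives the
    common divisors required. *)
Lemma extend_vring (L : fieldType) (psi : {rmorphism E -> L}) (O : set E) :
  is_vring iota O -> exists B : set L,
    is_vring (psi \o iota) B /\ forall e, B (psi e) <-> O e.
Proof.
move=> [Or Oval Oc].
have [| | | |B [Br AB SB Bval]] := @valuation_overring _ (psi @` O)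
    [set psi s | s in [set s | nonunits O s /\ s != 0]].
- split; first by exists 1; rewrite ?rmorph1 //; apply: subring1.
    by move=> _ _ [x Ox <-] [z Oz <-]; exists (x - z); rewrite ?rmorphB //; apply: subringB.
  by move=> _ _ [x Ox <-] [z Oz <-]; exists (x * z); rewrite ?rmorphM //; apply: subringM.
- by move=> _ [s [[Os _] _] <-]; exists s.
- move=> _ [s [Ms s0] <-] [x Ox]; rewrite -fmorphV => /fmorph_inj xE.
  by case/(nonunitsE Or Oval): Ms => [/eqP|]; rewrite ?(negPf s0) // -xE.
- have psiM w v : O w -> exists2 a, (psi @` O) a & psi (v * w) = psi v * a.
    by move=> Ow; exists (psi w); rewrite ?rmorphM //; exists w.
  move=> _ _ [s [Ms s0] <-] [s' [Ms' s'0] <-]; have [Oq|Oq] := Oval (s / s').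
    exists (psi s'); first by exists s'.
    by split; [rewrite -(divfK s'0 s) mulrC | rewrite -{1}[s']mulr1];
       apply: psiM => //; apply: subring1.
  exists (psi s); first by exists s.
  split; first by rewrite -{1}[s]mulr1; apply: psiM; apply: subring1.
  by rewrite -(divfK s0 s') mulrC; apply: psiM; move: Oq; rewrite invfM invrK mulrC.
exists B; split; first by split=> // c; apply: AB; exists (iota c).
move=> e; split=> [Be|Oe]; last by apply: AB; exists e.
apply: contrapT => Oe; apply: (SB (psi e^-1)); last by rewrite -fmorphV invrK.
exists e^-1 => //; split; first by apply/nonunitsE => //; right; rewrite invrK.
by rewrite invr_eq0; apply/eqP => e0; apply: Oe; rewrite e0; apply: subring0.
Qed.

Section Conjugate.
Variables (L : fieldType) (phi : {rmorphism F -> L}) (w : L).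
Let psi : {rmorphism E -> L} := phi \o in_alg F.
Hypothesis wE : w ^+ m = psi g.

(** Since the degree is [m], a polynomial vanishing at [y] is a multiple of [X^m - g], and therefore
    vanishes at every m-th root [w] of [g]. *)
Lemma conj_eq0 (p : {poly E}) : p^%:A.[y] = 0 -> (map_poly psi p).[w] = 0.
Proof.
move=> py; pose M := 'X^m - g%:P.
have My : M^%:A.[y] = 0.
  by rewrite rmorphB /= map_polyXn map_polyC /= !hornerE yE subrr.
have sM : size M = m.+1 by rewrite size_XnsubC.
have M0 : M != 0 by rewrite -size_poly_eq0 sM.
have r0 : p %% M = 0.
  apply: (gen_indep F_gen); first by rewrite dE -ltnS -sM ltn_modp.
  move: py; rewrite {1}(divp_eq p M) rmorphD rmorphM /= !hornerE.
  by rewrite [X in _ * X]My mulr0 add0r.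
rewrite (divp_eq p M) r0 addr0 rmorphM hornerM.
by rewrite rmorphB /= map_polyXn map_polyC !hornerE wE subrr mulr0.
Qed.

Lemma conj_eq (p q : {poly E}) : p^%:A.[y] = q^%:A.[y] -> (map_poly psi p).[w] = (map_poly psi q).[w].
Proof.
move=> pq; apply/eqP; rewrite -subr_eq0 -hornerN -hornerD -rmorphN -rmorphD; apply/eqP.
by apply: conj_eq0; rewrite rmorphB hornerD hornerN pq subrr.
Qed.

(** The preimage of [B] under the embedding of [F] into [L] taking [y] to [w]. Polynomial
    representatives avoid constructing that embedding; by [conj_eq] their choice is immaterial. *)
Definition conj_ring (B : set L) : set F :=
  [set z | exists p : {poly E}, z = p^%:A.[y] /\ B (map_poly psi p).[w]].

Lemma conj_vring (B : set L) : is_vring (psi \o iota) B -> is_vring cF (conj_ring B).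
Proof.
move=> [Br Bval Bc]; split.
- split.
  + by exists 1; rewrite !rmorph1 !hornerC; split=> //; apply: subring1.
  + move=> _ _ [p [-> Bp]] [q [-> Bq]]; exists (p - q).
    by rewrite !rmorphB !hornerE; split=> //; apply: subringB.
  + move=> _ _ [p [-> Bp]] [q [-> Bq]]; exists (p * q).
    by rewrite !rmorphM !hornerM; split=> //; apply: subringM.
- move=> z; have [p _ zE] := gen_span F_gen z; have [q _ ziE] := gen_span F_gen z^-1.
  have [z0|z0] := eqVneq z 0.
    by left; exists 0; rewrite !rmorph0 !horner0; split=> //; apply: subring0.
  have pq : (map_poly psi p).[w] * (map_poly psi q).[w] = 1.
    rewrite -hornerM -rmorphM (_ : 1 = (map_poly psi 1).[w]).
      by apply: conj_eq; rewrite rmorphM hornerM -zE -ziE rmorph1 hornerC divff.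
    by rewrite rmorph1 hornerC.
  have [Bp|Bp] := Bval (map_poly psi p).[w]; first by left; exists p.
  right; exists q; split=> //; move: Bp; rewrite -[X in B X]mul1r -pq mulrC mulKf //.
  by apply: contra_eq_neq pq => ->; rewrite mul0r eq_sym oner_eq0.
- move=> c; exists (iota c)%:P; rewrite !map_polyC !hornerC; split=> //; exact: Bc.
Qed.

Lemma restriction_conj (B : set L) (O : set E) : (forall e, B (psi e) <-> O e) ->
  restriction (conj_ring B) = O.
Proof.
move=> BO; apply/seteqP; split=> e; rewrite /restriction /=.
  move=> [p [eE]]; rewrite (@conj_eq p e%:P) ?map_polyC ?hornerC; first by move/BO.
  by rewrite -eE.
by move=> Oe; exists e%:P; rewrite !map_polyC !hornerC; split=> //; apply/BO.
Qed.

End Conjugate.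

(* Averaging over the conjugates y -> zeta ^ j y isolates the i-th component. *)
Lemma regular_component (O : set E) (p : {poly E}) : is_vring iota O -> (size p <= m)%N ->
  (forall O1, is_vring cF O1 -> restriction O1 = O -> O1 p^%:A.[y]) ->
  forall i, (i < m)%N -> O (p`_i ^+ m * g ^+ i).
Proof.
move=> Ov sp Op i im.
have mF : m%:R != 0 :> F by rewrite -(rmorph_nat cF) fmorph_eq0.
have [L [phi [zeta zetaP]]] := primitive_root_ex m0 mF.
pose psi : {rmorphism E -> L} := phi \o in_alg F.
have [B [Bv BO]] := extend_vring psi Ov; have [Br Bval Bc] := Bv.
have zm : zeta ^+ m = 1 := prim_expr_order zetaP.
have Bz j : B (zeta ^+ j).
  by apply: subringX => //; apply: (root_closed Br Bval m0); rewrite zm; apply: subring1.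
pose w j := zeta ^+ j * phi y.
have wE j : w j ^+ m = psi g.
  by rewrite exprMn -exprM mulnC exprM zm expr1n mul1r -rmorphXn yE.
have Bw j : B (map_poly psi p).[w j].
  have /(_ _) [||q [qE Bq]] := Op (conj_ring phi (w j) B).
  - exact: conj_vring.
  - exact: restriction_conj.
  by rewrite (conj_eq (wE j) qE).
pose a := psi p`_i * phi y ^+ i.
(* Orthogonality of roots of unity: the [l]-th term is multiplied by the sum over [j] of
   [zeta^((m - i + l) j)], which vanishes unless [l = i]. Writing [m - i] for [- i] keeps exponents
   natural. *)
have sumE : \sum_(j < m) zeta ^+ ((m - i) * j) * (map_poly psi p).[w j] = m%:R * a.
  have hE (j : 'I_m) : zeta ^+ ((m - i) * j) * (map_poly psi p).[w j] =
      \sum_(l < m) psi p`_l * phi y ^+ l * (zeta ^+ (m - i + l)) ^+ j.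
    rewrite (@horner_coef_wide _ m) ?size_map_poly // big_distrr /=.
    apply: eq_bigr => l _; rewrite coef_map /w exprMn -!exprM mulnDl exprD (mulnC j l); ring.
  rewrite (eq_bigr _ (fun j _ => hE j)) exchange_big /= (bigD1 (Ordinal im)) //=.
  rewrite [X in _ + X]big1 ?addr0 => [|l li]; rewrite -big_distrr /=.
    rewrite subnK 1?ltnW // zm (eq_bigr (fun=> 1)) => [|j _]; last by rewrite expr1n.
    by rewrite sumr_const card_ord mulrC.
  suff -> : \sum_(j < m) (zeta ^+ (m - i + l)) ^+ j = 0 by rewrite mulr0.
  have : (zeta ^+ (m - i + l) - 1) * \sum_(j < m) (zeta ^+ (m - i + l)) ^+ j = 0.
    by rewrite -subrX1 -exprM mulnC exprM zm expr1n subrr.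
  move/eqP; rewrite mulf_eq0 => /orP [|/eqP //]; rewrite subr_eq0.
  rewrite -(prim_order_dvd zetaP) => /dvdnP [q qE].
  have lm := ltn_ord l; case/eqP: li; apply: val_inj => /=.
  by case: q qE => [|[|q]]; rewrite ?mul0n ?mul1n ?mulSn; lia.
have mL : psi (iota m%:R) = m%:R by rewrite !rmorph_nat.
have Ba : B a.
  have -> : a = psi (iota m%:R^-1) * (m%:R * a).
    by rewrite !fmorphV mL mulKf // -mL !fmorph_eq0.
  rewrite -sumE; apply: subringM => //; first exact: Bc.
  by apply: subring_sum => // j _; apply: subringM.
(* Only the m-th power of [a] is sure to come from [E], where [B] restricts to [O]. *)
apply/BO; have -> : psi (p`_i ^+ m * g ^+ i) = a ^+ m; last exact: subringX.
by rewrite rmorphM !rmorphXn -(wE 0%N) /w expr0 mul1r exprMn -!exprM mulnC.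
Qed.

(** If the restriction had no nonzero nonunit, [O1] would contain [E], hence the root [y] of an
    element of [E], hence all of [F]. *)
Lemma restriction_place (O1 : set F) (t : F) : is_vring cF O1 -> t != 0 -> nonunits O1 t ->
  is_vring iota (restriction O1) /\
  exists2 e, e != 0 & nonunits (restriction O1) e.
Proof.
move=> O1v t0 Mt; have [Or1 Oval1 Oc1] := O1v.
have rv : is_vring iota (restriction O1).
  split=> [|e|c]; last exact: Oc1.
    split; first by rewrite /restriction /= scale1r; apply: subring1.
      by move=> e e' Oe Oe'; rewrite /restriction /= scalerBl; apply: subringB.
    by move=> e e' Oe Oe'; rewrite /restriction /= algM; apply: subringM.
  by have := Oval1 e%:A; rewrite /restriction /= algV.
have [Or Oval _] := rv; split=> //.
apply: contrapT => ne.
have OE e : O1 e%:A.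
  apply: contrapT => Oe; apply: ne; exists e^-1.
    by rewrite invr_eq0; apply/eqP => e0; apply: Oe; rewrite e0 scale0r; apply: subring0.
  by apply/nonunitsE => //; right; rewrite invrK.
have Oy : O1 y by apply: (root_closed Or1 Oval1 m0); rewrite yE.
have OF z : O1 z.
  have [p _ ->] := gen_span F_gen z; apply: subring_horner => // i.
  by rewrite coef_map; apply: OE.
by case/(nonunitsE Or1 Oval1): Mt => [/eqP|]; rewrite ?(negPf t0).
Qed.

Lemma monomial_regular (O1 : set F) (a : E) i : is_vring cF O1 ->
  restriction O1 (a ^+ m * g ^+ i) -> O1 (a *: y ^+ i).
Proof.
move=> [Or Oval _]; rewrite /restriction /= algM !algX -yE => Oa.
apply: (root_closed Or Oval m0); rewrite -mulr_algl exprMn -exprM mulnC.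
by rewrite exprM.
Qed.

End Components.

(** * Absolute and relative maximal elements *)

Section Combinatorics.
Variables (k F : fieldType) (iota : {rmorphism k -> F}) (n : nat) (Q : 'I_n -> set F).
Variables (m : nat) (t : 'I_n -> nat -> int) (N : nat -> int).
Hypotheses (n_ge2 : (2 <= n)%N) (m0 : (0 < m)%N).
Hypothesis tU : forall u i i' (x x' : int), (i < m)%N -> (i' < m)%N ->
  m%:Z * x + t u i = m%:Z * x' + t u i' -> i = i'.

(** [j] is integer valued because elements of the semigroup may have negative coordinates. *)
Definition of_class (i : nat) (j : 'I_n -> int) (a : {ffun 'I_n -> int}) : Prop :=
  (i < m)%N /\ forall u, a u = m%:Z * j u + t u i.

Hypothesis H1 : forall i j a, of_class i j a -> N i <= \sum_u j u -> Hhat iota Q a.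
(** [d] is meant to be the pole orders of a single component, one that attains the pole order of the
    whole function at [u]. *)
Hypothesis H2 : forall a u, Hhat iota Q a -> exists i j d,
  [/\ of_class i j d, N i <= \sum_u j u, forall l, d l <= a l & d u = a u].

(** By [tU], a component of [b] that attains [b u = a u] has the class of [a]. Within a class
    coordinates move by multiples of [m], so each strict inequality outside [J] lowers the sum of
    the [j] by at least 1. *)
Lemma nablaJ_class i j a (J : {set 'I_n}) : of_class i j a -> (0 < #|J|)%N ->
  nablaJ iota Q J a !=set0 <-> N i + (n - #|J|)%N%:Z <= \sum_u j u.
Proof.
move=> [im aE] /card_gt0P [u uJ].
have cJ : (n - #|J|)%N%:Z = \sum_(l : 'I_n) (l \notin J)%:Z.
  have -> : (n - #|J|)%N = #|~: J|%SET by have := cardsC J; rewrite card_ord; lia.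
  rewrite -sum1_card (big_morph Posz PoszD erefl) big_mkcond.
  by apply: eq_bigr => l _; rewrite inE; case: (l \in J).
split=> [[b [Hb bJ bnJ]]|le].
  have [i' [j' [d [[i'm dE] Nj' db dub]]]] := H2 u Hb.
  have ii' : i' = i by apply: (@tU u _ _ (j' u) (j u)) => //; rewrite -dE dub bJ // aE.
  rewrite ii' in dE Nj'; rewrite -lerBrDr cJ -sumrB; apply: le_trans Nj' _.
  apply: ler_sum => l _; have := db l; rewrite dE.
  case: (boolP (l \in J)) => lJ; first by rewrite bJ // aE; nia.
  by have := bnJ _ lJ; rewrite aE; nia.
pose j' l := j l - (l \notin J)%:Z.
exists [ffun l => m%:Z * j' l + t l i]; split.
- apply: (@H1 i j'); first by split=> // l; rewrite ffunE.
  by rewrite sumrB -cJ lerBrDr.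
- by move=> l lJ; rewrite ffunE aE /j' lJ subr0.
- by move=> l lJ; rewrite ffunE aE /j' lJ ltrD2r; nia.
Qed.

(** The case of the full index set in [nablaJ_class], where [nablaJ] can contain only [a] itself. *)
Lemma Hhat_class i j a : of_class i j a -> Hhat iota Q a <-> N i <= \sum_u j u.
Proof.
move=> ca; have := nablaJ_class (J := finset.setT) ca.
rewrite cardsT card_ord subnn addr0 => <-; last exact: ltnW.
split=> [Ha|[b [Hb ba _]]]; first by exists a; split=> // l; rewrite inE.
by have -> : a = b by apply/ffunP => l; rewrite ba ?inE.
Qed.

Lemma maximal_class i j a : of_class i j a ->
  maximal iota Q a <-> N i <= \sum_u j u < N i + (n - 1)%N%:Z.
Proof.
move=> ca; have s1 (u : 'I_n) : (0 < #|[set u]%SET|)%N by rewrite cards1.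
have nE u := nablaJ_class ca (s1 u).
rewrite /maximal (Hhat_class ca); split=> [[-> nab]|/andP[-> lt]] /=.
  rewrite ltNge; apply/negP; pose u := Ordinal (ltnW n_ge2).
  rewrite -(cards1 u) => /nE [b nb].
  by have : set0 b by rewrite -nab; exists u.
split=> //; apply/seteqP; split=> // b [u _ nb].
have : nablaJ iota Q [set u]%SET a !=set0 by exists b.
by move/nE; rewrite cards1; lia.
Qed.

Lemma exists_card_set c : (c <= n)%N -> exists J : {set 'I_n}, #|J| = c.
Proof.
move=> cn; exists [set widen_ord cn u | u : 'I_c].
by rewrite card_imset ?cardsT ?card_ord // => u v [] /val_inj.
Qed.

Lemma nablaJ_class0 i j a (J : {set 'I_n}) : of_class i j a -> (0 < #|J|)%N ->
  nablaJ iota Q J a = set0 <-> \sum_u j u < N i + (n - #|J|)%N%:Z.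
Proof.
move=> ca J0; rewrite ltNge; split=> [n0|/negP le].
  by apply/negP => /(nablaJ_class ca J0); rewrite n0 => -[].
by apply/seteqP; split=> // b nb; apply: le; apply/(nablaJ_class ca J0); exists b.
Qed.

Lemma properT_card (J : {set 'I_n}) : (J \proper finset.setT) = (#|J| < n)%N.
Proof. by rewrite properEcard finset.subsetT cardsT card_ord. Qed.

Lemma Gamma_hat_class i j a : of_class i j a ->
  Gamma_hat iota Q a <-> \sum_u j u = N i.
Proof.
move=> ca; rewrite /Gamma_hat /= (maximal_class ca); split=> [[/andP[ge lt] gam]|sE].
  (* For [n = 2] no proper [J] has two elements, but maximality alone leaves only the value [N i].
     Otherwise [#|J| = n - 1] gives the sharpest bound. *)
  have [n2|n2] := eqVneq n 2%N; first by
    have n1 : (n - 1 = 1)%N by [rewrite n2]; move: ge lt; rewrite n1;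
    move: (\sum_u j u) => S; lia.
  have [|J cJ] := @exists_card_set n.-1; first by lia.
  have J0 : (0 < #|J|)%N by rewrite cJ; lia.
  have /(nablaJ_class0 ca J0) : nablaJ iota Q J a = set0.
    by apply: gam; rewrite ?properT_card cJ; lia.
  by move: ge lt; rewrite cJ; move: (\sum_u j u) => S; lia.
split=> [|J]; first by rewrite sE; lia.
rewrite properT_card => Jn J2; have J0 : (0 < #|J|)%N by apply: leq_trans J2.
by apply/(nablaJ_class0 ca J0); rewrite sE; move: Jn J2; move: #|J| => c; lia.
Qed.

Lemma Lambda_hat_class i j a : of_class i j a ->
  Lambda_hat iota Q a <-> \sum_u j u = N i + (n - 2)%N%:Z.
Proof.
move=> ca; rewrite /Lambda_hat /= (maximal_class ca); split=> [[/andP[ge lt] lam]|sE].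
  (* A [J] with two elements gives the lower bound [N i + n - 2], which meets the upper bound from
     maximality. It is proper only for [n > 2]; for [n = 2] maximality suffices. *)
  have [n2|n2] := eqVneq n 2%N; first by
    have [n1 n0] : (n - 1 = 1)%N /\ (n - 2 = 0)%N by [rewrite n2];
    move: ge lt; rewrite n1 n0; move: (\sum_u j u) => S; lia.
  have [|J cJ] := @exists_card_set 2; first by lia.
  have J0 : (0 < #|J|)%N by rewrite cJ.
  have /(nablaJ_class ca J0) : nablaJ iota Q J a !=set0.
    by apply: lam; rewrite ?properT_card cJ; lia.
  by move: ge lt; rewrite cJ; move: (\sum_u j u) => S; lia.
split=> [|J]; first by rewrite sE; lia.
rewrite properT_card => Jn J2; have J0 : (0 < #|J|)%N by apply: leq_trans J2.
by apply/(nablaJ_class ca J0); rewrite sE; move: Jn J2; move: #|J| => c; lia.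
Qed.

Lemma maximal_nabla a u b : maximal iota Q a -> ~ nablaJ iota Q [set u]%SET a b.
Proof. by move=> [_ nab] nb; have : set0 b by rewrite -nab; exists u. Qed.

Lemma equal_or_nabla (a d : {ffun 'I_n -> int}) i j u : of_class i j d -> N i <= \sum_u j u ->
  (forall l, d l <= a l) -> d u = a u ->
  a = d \/ exists J : {set 'I_n}, [/\ u \in J, J \proper finset.setT & nablaJ iota Q J a d].
Proof.
move=> cd Nd da dau; pose J := [set l | d l == a l]%SET.
have [Jp|Jp] := boolP (J \proper finset.setT).
  right; exists J; split=> //; first by rewrite inE dau.
  split; first exact: H1 Nd.
    by move=> l; rewrite inE => /eqP.
  by move=> l; rewrite inE => dl; rewrite lt_neqAle dl da.
left; apply/ffunP => l; move: Jp; rewrite properT negbK => /eqP JT.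
have : l \in J by rewrite JT inE.
by rewrite inE => /eqP.
Qed.

(** A component reaching [a] at [u] either equals [a] or lies in some [nablaJ] with [J] proper and
    nonempty, which absolute maximality excludes. *)
Lemma Gamma_hat_has_class a : Gamma_hat iota Q a -> exists i j, of_class i j a.
Proof.
move=> [amax gam]; pose u := Ordinal (ltnW n_ge2).
have [i [j [d [cd Nd da dau]]]] := H2 u (proj1 amax).
exists i, j; have [-> //|[J [uJ Jp nJ]]] := equal_or_nabla cd Nd da dau.
have [J2|J1] := leqP 2 #|J|; first by have : set0 d by rewrite -(gam J).
have J1' : J = [set u]%SET.
  apply/esym/eqP; rewrite eqEcard cards1 -ltnS J1 andbT.
  by rewrite finset.sub1set.
by case: (maximal_nabla amax (u := u) (b := d)); rewrite -J1'.
Qed.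

(** For each [l], relative maximality gives a [b] agreeing with [a] at [u] and [l] and smaller
    elsewhere. Its component reaching [a u] has the class found at [u]; it must reach [a l] too,
    since otherwise it would lie in the empty [nablaJ] of [u] alone. So all coordinates of [a] share
    one class. *)
Lemma Lambda_hat_has_class a : Lambda_hat iota Q a -> exists i j, of_class i j a.
Proof.
move=> [amax lam]; pose u := Ordinal (ltnW n_ge2).
have [i [j [d [cd Nd da dau]]]] := H2 u (proj1 amax).
have [n2|n2] := eqVneq n 2%N.
  apply: Gamma_hat_has_class; split=> // J; rewrite properT_card => Jn J2; lia.
suff xl l : exists x, a l = m%:Z * x + t l i.
  have [j' j'E] := choice xl; exists i, j'; split=> //; by case: cd.
have [->|lu] := eqVneq l u.
  by exists (j u); rewrite -dau; case: cd.
have cJ : #|[set u; l]%SET| = 2%N by rewrite cards2 eq_sym lu.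
have [||b [Hb bJ bnJ]] := lam [set u; l]%SET; [rewrite properT_card cJ; lia | by rewrite cJ |].
have [i' [j' [d' [cd' Nd' db' dbu']]]] := H2 u Hb.
have bu : b u = a u by apply: bJ; rewrite !inE eqxx.
have bl : b l = a l by apply: bJ; rewrite !inE eqxx orbT.
have ii' : i' = i.
  case: cd cd' => im dE [i'm d'E]; apply: (@tU u _ _ (j' u) (j u)) => //.
  by rewrite -d'E -dE dbu' dau.
have [d'l|d'l] := eqVneq (d' l) (a l).
  by exists (j' l); rewrite -d'l -ii'; case: cd'.
case: (maximal_nabla amax (u := u) (b := d')); split; first exact: H1 Nd'.
  by move=> v; rewrite inE => /eqP ->; rewrite dbu'.
move=> v; rewrite inE => vu; have [->|vl] := eqVneq v l.
  by rewrite lt_neqAle d'l -bl db'.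
by apply: le_lt_trans (db' v) (bnJ _ _); rewrite !inE negb_or vu vl.
Qed.

End Combinatorics.

(** * Counting compositions *)

(** Parts of a composition of [M] are at most [M], so bounded tuples suffice. For [M < 0] there is
    none, and the binomial vanishes because [M + n < n]. *)
Lemma count_compositions (n : nat) (M : int) :
  #|[set x : n.+1.-tuple 'I_(absz M).+1 | (\sum_(l <- x) (l : nat))%N%:Z == M]%SET| =
  binomz (M + n%:Z) n.
Proof.
case: M => c /=.
  rewrite addnC -card_ord_partitions; apply: eq_card => x; rewrite !inE eqz_nat.
  by [].
rewrite (eq_card (B := pred0)) ?card0; last by move=> x; rewrite inE.
rewrite /binomz; case E : (Negz c + n%:Z) => [e|//].
by rewrite bin_small //; lia.
Qed.

(** The bound on the parts depends on [i], hence the encoding by dependent pairs; as [h] is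
    injective, counting parameters counts values. *)
Lemma card_compositions (n m : nat) (M : nat -> int)
  (h : nat -> {ffun 'I_n.+1 -> nat} -> {ffun 'I_n.+1 -> int}) :
  (forall i i' j j', (i < m)%N -> (i' < m)%N -> h i j = h i' j' -> i = i' /\ j = j') ->
  ([set a | exists (i : nat) (j : {ffun 'I_n.+1 -> nat}),
      [/\ (1 <= i <= m - 1)%N, (\sum_k j k)%N%:Z = M i & a = h i j]]
    #= `I_(\sum_(1 <= i < m) binomz (M i + n%:Z) n))%card.
Proof.
move=> hinj.
pose T := {i : 'I_m & n.+1.-tuple 'I_(absz (M i)).+1}.
pose X := [set u : T | (0 < tag u)%N &&
  ((\sum_(x <- tagged u) (x : nat))%N%:Z == M (tag u))]%SET.
pose jf (u : T) : {ffun 'I_n.+1 -> nat} := [ffun l => tnth (tagged u) l : nat].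
have sumjf (u : T) : (\sum_l jf u l = \sum_(x <- tagged u) (x : nat))%N.
  by rewrite big_tuple; apply: eq_bigr => l _; rewrite ffunE.
have XE : #|X| = (\sum_(1 <= i < m) binomz (M i + n%:Z) n)%N.
  rewrite -sum1_card (partition_big (fun u : T => tag u) xpredT) //=.
  rewrite (big_nat_widenl 1 0) // big_mkord [RHS]big_mkcond /=.
  apply: eq_bigr => i _; case: ifP => i0; last first.
    by rewrite big_pred0 // => -[i' x]; rewrite inE /=; apply/negP => /andP[/andP[+ _] /eqP ii']; rewrite ii' i0.
  have inj : injective (@Tagged _ i (fun i : 'I_m => n.+1.-tuple 'I_(absz (M i)).+1)).
    by move=> x x' /eqP; rewrite -tag_eqE /tag_eq /= eqxx tagged_asE => /eqP.
  rewrite -count_compositions -(card_imset _ inj) sum1dep_card.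
  apply: eq_card => u; rewrite inE; apply/andP/imsetP => [[]|[x]]; last first.
    by rewrite inE => sx ->; rewrite inE /= i0 sx.
  case: u => i' x; rewrite inE /= => /andP[_ sx] /eqP ii'; subst i'.
  by exists x; rewrite ?inE.
have jf_inj (i : 'I_m) (x y : n.+1.-tuple 'I_(absz (M i)).+1) :
    jf (Tagged _ x) = jf (Tagged _ y) -> x = y.
  move=> xy; apply: eq_from_tnth => l; apply: val_inj.
  by have := congr1 (fun f : {ffun 'I_n.+1 -> nat} => f l) xy; rewrite !ffunE.
pose H (v : 'I_#|X|) := h (tag (enum_val v)) (jf (enum_val v)).
have -> : [set a | exists (i : nat) (j : {ffun 'I_n.+1 -> nat}),
      [/\ (1 <= i <= m - 1)%N, (\sum_k j k)%N%:Z = M i & a = h i j]] =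
    [set H v | v in [set: 'I_#|X|]].
  apply/seteqP; split=> a.
    move=> [i [j [/andP[i0 im] sj ->]]].
    have {}im : (i < m)%N by lia.
    have jM l : (j l < (absz (M (Ordinal im))).+1)%N.
      by rewrite ltnS /= -sj /= (bigD1 l) //= leq_addr.
    pose u : T := Tagged _ [tuple Ordinal (jM l) | l < n.+1].
    have jfu : jf u = j by apply/ffunP => l; rewrite ffunE tnth_mktuple.
    have uX : u \in X by rewrite inE /= i0 /=; have := sumjf u; rewrite jfu /= => <-; rewrite sj.
    by exists (enum_rank_in uX u) => //; rewrite /H enum_rankK_in // jfu.
  move=> [v _ <-]; have := enum_valP v; rewrite inE => /andP[i0 /eqP sj].
  exists (tag (enum_val v)), (jf (enum_val v)); split=> //; last by rewrite sumjf.
  by rewrite i0 /= -ltnS subn1 prednK ?ltn_ord // (leq_trans _ (ltn_ord (tag (enum_val v)))).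
rewrite -XE; apply: card_eq_trans (_ : [set: 'I_#|X|] #= _)%card; last by rewrite card_eq_sym card_II.
apply: inj_card_eq => v v' _ _ /hinj [] // /val_inj tagE jfE.
apply: enum_val_inj; case: (enum_val v) (enum_val v') tagE jfE => [i x] [i' x'] /= ii'.
by case: i' / ii' x' => x' /jf_inj ->.
Qed.

(** * The generalized Weierstrass semigroup *)

Lemma coprime_mul_inj (m : nat) (l : int) (i i' : nat) : coprimez m l -> (i < m)%N -> (i' < m)%N ->
  (m%:Z %| i%:Z * l - i'%:Z * l)%Z -> i = i'.
Proof.
move=> cop im i'm; rewrite -mulrBl Gauss_dvdzl // dvdzE /=.
have [//|ii'] := eqVneq i i'; move/dvdn_leq; suff : (0 < absz (i%:Z - i'%:Z) < m)%N by lia.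
by lia.
Qed.

Section Semigroup.
Variables (K : finFieldType) (E : fieldType) (tf : {rmorphism {poly K} -> E}).
Hypotheses (tf_inj : injective tf)
  (tf_frac : forall z, exists p q : {poly K}, [/\ q != 0, coprimep p q & z = tf p / tf q]).
Variables (F : fieldExtType E) (m : nat) (f : {poly K}) (s : seq K) (y : F).
Hypotheses (m_gt1 : (1 < m)%N) (mK : m%:R != 0 :> K) (f0 : f != 0)
  (fs : f %= \prod_(a <- s) ('X - a%:P))
  (f_not_power : forall d : nat, (1 < d)%N -> (d %| m)%N -> ~ exists g : E, tf f = g ^+ d)
  (yE : y ^+ m = (tf f)%:A) (F_gen : <<1; y>>%VS = {:F}%VS).
Notation cF := (const_ext (rat_cst tf) F).
Notation nub c := (nu (rat_place tf c)).
Variables (n : nat) (b : 'I_n -> option K) (Q : 'I_n -> set F).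
Hypotheses (b_inj : injective b) (n_gt0 : (0 < n)%N) (n_le : (n <= #|K|)%N).
Hypothesis Q_place : forall u, place cF (Q u).
Hypothesis Q_ram : forall u, ramification_index (Q u) (rat_place tf (b u)) (\dim {:F}).
Hypothesis Q_uniq : forall u Q', place cF Q' -> lies_over Q' (rat_place tf (b u)) -> Q' = Q u.

Definition order_at c : int := nub c (tf f).
Notation lam := order_at.

Definition class_residue (u : 'I_n) (i : nat) : int := ((i%:Z * lam (b u)) %% m)%Z.

(** The ceiling of [i * lam c / m], as integer division by a positive number rounds down. It is the
    least order at [c] allowed for the coefficient of a regular [a y^-i]. *)
Definition ceil_order (i : nat) c : int := - ((- (i%:Z * lam c)) %/ m)%Z.

(** The least sum of the [j u] compatible with degree 0: floors where the order of the coefficient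
    is read off from [j u], ceilings where it is only bounded below. *)
Definition class_bound (i : nat) : int :=
  \sum_u ((i%:Z * lam (b u)) %/ m)%Z + \sum_(c | c \notin codom b) ceil_order i c.

Let m0 : (0 < m)%N. Proof. exact: ltnW. Qed.

Lemma uniformizer_at u : exists O' p,
  [/\ is_vring cF O', Q u = nonunits O', nonunits O' p, p != 0
    & prime_element (Q u) p /\
      forall z : E, z != 0 -> has_val O' p z%:A ((\dim {:F})%:Z * nub (b u) z)].
Proof.
have [Ov Mu] := rat_ringP tf_inj (b u).
apply: (ramified_uniformizer Ov (unif_neq0 tf_inj (b u)) Mu _ (Q_place u) (Q_ram u)).
by move=> z z0; apply: rat_nu.
Qed.

Lemma dim_m : \dim {:F} = m.
Proof.
have [O' [p [Ov' _ Mp p0 [_ hv]]]] := uniformizer_at (Ordinal n_gt0).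
exact: (cover_dim tf_inj tf_frac m_gt1 f0 fs f_not_power yE F_gen Ov' Mp p0 hv).
Qed.

Lemma coprime_order_at u : coprimez m (lam (b u)).
Proof.
have [O' [p [Ov' _ Mp p0 [_ hv]]]] := uniformizer_at u.
exact: (cover_coprime tf_inj tf_frac m_gt1 mK f0 fs f_not_power yE F_gen Ov' Mp p0 hv).
Qed.

Lemma class_residue_inj u i i' (x x' : int) : (i < m)%N -> (i' < m)%N ->
  m%:Z * x + class_residue u i = m%:Z * x' + class_residue u i' -> i = i'.
Proof.
move=> im i'm e; apply: (coprime_mul_inj (coprime_order_at u) im i'm); apply/dvdzP.
exists (((i%:Z * lam (b u)) %/ m)%Z - x - ((i'%:Z * lam (b u)) %/ m)%Z + x').
move: e; rewrite {1}(divz_eq (i%:Z * lam (b u)) m) {1}(divz_eq (i'%:Z * lam (b u)) m).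
rewrite /class_residue; move: (_ %/ _)%Z (_ %/ _)%Z (_ %% _)%Z (_ %% _)%Z => q q' r r'; clear; lia.
Qed.

(* In the basis of the powers of y^-1, the pole order at Q u of the i-th
   component is congruent to class_residue u i. *)
Let y0 := y^-1.
Let g := (tf f)^-1.

Let y0E : y0 ^+ m = g%:A.
Proof. by rewrite exprVn yE algV. Qed.

Let F_gen0 : <<1; y0>>%VS = {:F}%VS.
Proof.
apply/eqP; rewrite eqEsubv subvf /= -F_gen; apply/FadjoinP; split; first exact: sub1v.
by rewrite -[y]invrK rpredV memv_adjoin.
Qed.

(** At [Q u], [m] times the order of [y] is the order of [f], that is [m * lam (b u)]; so [y] has
    order [lam (b u)]. *)
Lemma monomial_val u : exists O' p,
  [/\ is_vring cF O', Q u = nonunits O', nonunits O' p, p != 0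
    & prime_element (Q u) p /\ forall (a : E) i, a != 0 ->
      has_val O' p (a *: y0 ^+ i) (m%:Z * nub (b u) a - i%:Z * lam (b u))].
Proof.
have [O' [p [Ov' QE Mp p0 [pp hv]]]] := uniformizer_at u; have [Or' Oval' _] := Ov'.
exists O', p; split=> //; split=> // a i a0.
have y_neq0 : y != 0 := gen_neq0 tf_inj m_gt1 f0 yE.
have [l hy] := ramified_val Ov' Mp p0 hv y_neq0.
have lE : l = lam (b u).
  have := has_val_uniq Or' Oval' Mp p0 (has_valX Or' m hy).
  rewrite yE => /(_ _ (hv _ (tf_f_neq0 tf_inj f0))); rewrite dim_m mulrC => /mulfI -> //.
  by have := m0; lia.
rewrite -mulr_algl; apply: has_valM => //; first by rewrite -dim_m; apply: hv.
have -> : - (i%:Z * lam (b u)) = - l * i%:Z by rewrite lE; ring.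
by apply: has_valX => //; apply: has_valV.
Qed.

Lemma restriction_ramified u (O' : set F) : is_vring cF O' -> Q u = nonunits O' ->
  restriction O' = rat_ring tf (b u).
Proof.
move=> Ov QE; have [O1 [p [Ov' QE' Mp p0 [_ hv]]]] := uniformizer_at u.
have [Or Oval _] := Ov; have [Or' Oval' _] := Ov'.
have -> : O' = O1 by rewrite -(val_ring_nonunits Or Oval) -QE QE' (val_ring_nonunits Or' Oval').
apply/seteqP; split=> e; rewrite /restriction /=.
  have [->|e0] := eqVneq e 0; first by move=> _; apply: subring0; case: (rat_ringP tf_inj (b u)) => -[].
  move/(has_val_ringP Or' Oval' Mp p0 (hv _ e0)) => v0; apply/rat_nu_ring => //.
  by move: v0; rewrite dim_m pmulr_rge0 // ltz_nat.
have [->|e0] := eqVneq e 0; first by move=> _; rewrite scale0r; apply: subring0.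
move=> Oe; apply/(has_val_ringP Or' Oval' Mp p0 (hv _ e0)).
by rewrite dim_m pmulr_rge0 ?ltz_nat //; apply/rat_nu_ring.
Qed.

Lemma sum_codom (G : option K -> int) :
  \sum_c G c = \sum_u G (b u) + \sum_(c | c \notin codom b) G c.
Proof.
rewrite (bigID [pred c | c \in codom b]) /=; congr (_ + _).
rewrite -big_uniq /=; last by rewrite map_inj_uniq ?enum_uniq.
by rewrite codomE big_map big_enum.
Qed.

Lemma exists_not_codom : exists c, ~~ (c \in codom b).
Proof.
apply: contrapT => nc; have cT : codom b =i predT.
  by move=> c; rewrite inE; apply: contrapT => cb; apply: nc; exists c; apply/negP.
have := card_codom b_inj; rewrite (eq_card cT) card_option card_ord => cn.
by move: n_le; rewrite -cn ltnn.
Qed.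

Lemma ceil_orderP i c (v : int) : (ceil_order i c <= v) = (0 <= m%:Z * v - i%:Z * lam c).
Proof.
rewrite /ceil_order lerNl lez_divRL ?ltz_nat // mulNr lerN2 subr_ge0.
by rewrite (mulrC v).
Qed.

Lemma tf_units O : nonrational tf O -> ring_units O (tf f).
Proof. exact: (split_poly_units tf_inj tf_frac fs). Qed.

Lemma nub_monomial (a : E) i c : a != 0 ->
  nub c (a ^+ m * g ^+ i) = m%:Z * nub c a - i%:Z * lam c.
Proof.
move=> a0; have g0 : g != 0 by rewrite invr_eq0; apply: tf_f_neq0.
rewrite rat_nuM ?expf_neq0 // !rat_nuX // rat_nuV //; last exact: tf_f_neq0.
by rewrite /order_at; ring.
Qed.

Lemma monomial_Hhat i j a : of_class m class_residue i j a ->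
  class_bound i <= \sum_u j u -> Hhat cF Q a.
Proof.
move=> [im aE] le.
(* At [b u] the order that produces the pole order [a u], elsewhere the least order allowed; the
   total is [class_bound i - \sum_u j u]. *)
pose e c := if [pick u | b u == c] is Some u then ((i%:Z * lam c) %/ m)%Z - j u else ceil_order i c.
have eb u : e (b u) = ((i%:Z * lam (b u)) %/ m)%Z - j u.
  by rewrite /e; case: pickP => [u' /eqP /b_inj ->|/(_ u)] //; rewrite eqxx.
have ec c : c \notin codom b -> e c = ceil_order i c.
  by rewrite /e; case: pickP => [u /eqP <-|//]; rewrite codom_f.
have [|d [d0 dT dge dO]] := @exists_divisor _ _ _ tf_inj tf_frac [pred c | c \in codom b] e exists_not_codom.
  rewrite sum_codom (eq_bigr _ (fun u _ => eb u)) (eq_bigr _ ec) sumrB.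
  by rewrite addrAC subr_le0.
have y_neq0 : y != 0 := gen_neq0 tf_inj m_gt1 f0 yE.
exists (d *: y0 ^+ i); split.
- move=> Q' Q'pl Q'n; have [O1 [t1 [O1v t10 Mt1 Q'E]]] := placeP Q'pl.
  have [Or1 Oval1 _] := O1v; rewrite Q'E val_ring_nonunits //.
  apply: (monomial_regular m0 y0E O1v).
  have [Ov _] := restriction_place m0 y0E F_gen0 O1v t10 Mt1; have [Or Oval _] := Ov.
  have [[c Oc]|nr] := pselect (exists c, restriction O1 = rat_ring tf c).
    have dg0 : d ^+ m * g ^+ i != 0.
      by rewrite mulf_neq0 ?expf_neq0 ?invr_eq0 //; apply: tf_f_neq0.
    rewrite Oc; apply/rat_nu_ring => //; rewrite nub_monomial // -ceil_orderP.
    have [/codomP [u cu]|cb] := boolP (c \in codom b); last by rewrite -ec.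
    (* A place whose ring restricts to the one at [b u] lies over it, so it is [Q u], where nothing
       has to be checked. *)
    case: (Q'n u); apply: Q_uniq => // _ [x Mx <-].
    move: Mx; rewrite -cu /rat_place -Oc Q'E => /(nonunitsE Or Oval).
    move=> [->|nx]; first by rewrite scale0r; apply: nonunits0.
    apply/nonunitsE => //; right; apply: contra_not nx; rewrite /restriction /=.
    by rewrite algV.
  have nrO : nonrational tf (restriction O1) by split=> // c Oc; apply: nr; exists c.
  apply: subringM => //; first by apply: subringX => //; apply: dO.
  by apply: subringX => //; have [] := unitsV (tf_units nrO).
- by rewrite scaler_eq0 negb_or d0 expf_neq0 // invr_eq0.
apply/ffunP => u; rewrite ffunE.
have [O' [p [Ov' QE Mp p0 [pp hv]]]] := monomial_val u; have [Or' Oval' _] := Ov'.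
rewrite QE in pp *; rewrite (nu_has_val Or' Oval' Mp p0 pp (hv d i d0)) dT ?inE ?codom_f // eb aE.
rewrite {2}(divz_eq (i%:Z * lam (b u)) m) /class_residue; ring.
Qed.

Lemma Hhat_component a u : Hhat cF Q a -> exists i j d,
  [/\ of_class m class_residue i j d, class_bound i <= \sum_u j u,
      forall l, d l <= a l & d u = a u].
Proof.
move=> [z [zreg z0 aE]].
have [p sp zE] := gen_span F_gen0 z; rewrite dim_m in sp.
have compO O : is_vring (rat_cst tf) O -> (forall u, O <> rat_ring tf (b u)) ->
    forall i, (i < m)%N -> O (p`_i ^+ m * g ^+ i).
  move=> Ov nO i im; have [Or Oval _] := Ov.
  (* Without a nonzero nonunit [O] is all of [E]. Otherwise every ring restricting to [O] belongs to
     a genuine place, at which [z] is regular. *)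
  have [[e e0 Me]|ne] := pselect (exists2 e, e != 0 & nonunits O e); last first.
    apply: contrapT => nOx; set x := _ * _ in nOx; apply: ne; exists x^-1.
      by rewrite invr_eq0; apply/eqP => x0; apply: nOx; rewrite x0; apply: subring0.
    by apply/nonunitsE => //; right; rewrite invrK.
  apply: (regular_component m0 mK y0E F_gen0 dim_m Ov sp) => // O1 O1v O1E.
  have [Or1 Oval1 _] := O1v.
  have eA0 : e%:A != 0 :> F by rewrite scaler_eq0 negb_or e0 oner_eq0.
  have MeA : nonunits O1 e%:A.
    apply/nonunitsE => //; right; move/(nonunitsE Or Oval): Me => [/eqP|]; rewrite ?(negPf e0) //.
    by apply: contra_not; rewrite -O1E /restriction /= algV.
  rewrite -zE -(val_ring_nonunits Or1 Oval1); apply: zreg; first exact: place_nonunits MeA.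
  by move=> l O1Q; apply: (nO l); rewrite -O1E; apply: restriction_ramified.
pose zi (i : 'I_m) := p`_i *: y0 ^+ i.
have zsum : z = \sum_i zi i.
  rewrite zE (@horner_coef_wide _ m) ?size_map_poly //; apply: eq_bigr => i _.
  by rewrite coef_map /= mulr_algl.
have y_neq0 : y != 0 := gen_neq0 tf_inj m_gt1 f0 yE.
have zi0 i : (zi i != 0) = (p`_i != 0).
  by rewrite scaler_eq0 negb_or expf_neq0 ?invr_eq0 ?andbT.
pose v l (i : 'I_m) := m%:Z * nub (b l) p`_i - i%:Z * lam (b l).
have main l : exists i0 : 'I_m, [/\ p`_i0 != 0, nu (Q l) z = v l i0 &
    forall i : 'I_m, p`_i != 0 -> v l i0 <= v l i].
  have [O' [q [Ov' QE Mq q0 [qq hv]]]] := monomial_val l; have [Or' Oval' _] := Ov'.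
  have [| | |i0 [pi0 hi0 mini]] := has_val_sum Or' Oval' Mq q0 (z := zi) (s := v l).
  - by move=> i; rewrite zi0; apply: hv.
  - move=> i i' _ _ vv; apply: val_inj => /=.
    apply: (coprime_mul_inj (coprime_order_at l) (ltn_ord i) (ltn_ord i')); apply/dvdzP.
    by exists (nub (b l) p`_i - nub (b l) p`_i'); move: vv; rewrite /v; lia.
  - apply: contrapT => nz; move/eqP: z0; apply; rewrite zsum big1 // => i _.
    by apply/eqP; apply: contraT => zi'; case: nz; exists i.
  exists i0; rewrite -zi0; split=> //; last by move=> i; rewrite -zi0; apply: mini.
  by rewrite QE in qq *; rewrite zsum; apply: (nu_has_val Or' Oval' Mq q0 qq hi0).
have [i [pi0 nui _]] := main u.
pose j l := ((i%:Z * lam (b l)) %/ m)%Z - nub (b l) p`_i.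
exists i, j, [ffun l => - v l i]; split.
- split=> // l; rewrite ffunE /v /j {1}(divz_eq (i%:Z * lam (b l)) m) /class_residue; ring.
(* At nonrational places [g] is a unit, so regularity of the component passes to its coefficient,
   and [degree_le0] applies. *)
- have : \sum_c nub c p`_i <= 0.
    apply: degree_le0 => // O [Ov nO]; have [Or Oval _] := Ov.
    have Og : ring_units O g by apply: unitsV; apply: tf_units.
    apply: (root_closed Or Oval m0).
    have -> : p`_i ^+ m = p`_i ^+ m * g ^+ i * (g ^+ i)^-1 by case: Og => g0 _ _; rewrite mulfK // expf_neq0.
    apply: subringM => //; first exact: compO.
    by have [] := unitsX Or i Og.
  rewrite sum_codom sumrB => le; rewrite lerBrDr /class_bound.
  rewrite -addrA gerDl addrC; apply: le_trans le; rewrite lerD2l.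
  apply: ler_sum => c cb; rewrite ceil_orderP -nub_monomial //; apply/rat_nu_ring => //.
    by rewrite mulf_neq0 ?expf_neq0 ?invr_eq0 //; apply: tf_f_neq0.
  apply: compO => //; first by case: (rat_ringP tf_inj c).
  move=> l cl; have /(rat_place_inj tf_inj tf_frac) cbl : rat_place tf c = rat_place tf (b l).
    by rewrite /rat_place cl.
  by move: cb; rewrite cbl codom_f.
- move=> l; rewrite aE !ffunE lerN2; have [i0 [_ -> mini]] := main l; exact: mini.
by rewrite aE !ffunE nui.
Qed.

End Semigroup.

(** * From rational places to the enumeration [P], and the two formulas *)

Lemma ceil_ratE (x : int) (m : nat) : (0 < m)%N ->
  Num.ceil (x%:~R / m%:R : rat) = - ((- x) %/ m)%Z.
Proof.
move=> m0; have mQ : 0 < m%:R :> rat by rewrite ltr0n.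
have leE (v : int) : (Num.ceil (x%:~R / m%:R : rat) <= v) = (- ((- x) %/ m)%Z <= v).
  rewrite ceil_le_int ler_pdivrMr // lerNl lez_divRL ?ltz_nat // mulNr lerN2.
  by rewrite -[m%:R]/((m%:Z)%:~R) -intrM ler_int.
by apply/eqP; rewrite eq_le leE lexx -leE lexx.
Qed.

Lemma card_compositions_pos (n m : nat) (M : nat -> int)
  (h : nat -> {ffun 'I_n -> nat} -> {ffun 'I_n -> int}) : (0 < n)%N ->
  (forall i i' j j', (i < m)%N -> (i' < m)%N -> h i j = h i' j' -> i = i' /\ j = j') ->
  ([set a | exists (i : nat) (j : {ffun 'I_n -> nat}),
      [/\ (1 <= i <= m - 1)%N, (\sum_k j k)%N%:Z = M i & a = h i j]]
    #= `I_(\sum_(1 <= i < m) binomz (M i + (n - 1)%N%:Z) (n - 1)))%card.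
Proof. by case: n h => // n h _; rewrite subSS subn0; apply: card_compositions. Qed.

Section Superelliptic.
Variables (K : finFieldType) (E : fieldType) (tf : {rmorphism {poly K} -> E}).
Hypotheses (tf_inj : injective tf)
  (tf_frac : forall z, exists p q : {poly K}, [/\ q != 0, coprimep p q & z = tf p / tf q]).
Variables (F : fieldExtType E) (m : nat) (f : {poly K}) (s : seq K) (y : F).
Hypotheses (m_gt1 : (1 < m)%N) (mK : m%:R != 0 :> K) (f0 : f != 0)
  (fs : f %= \prod_(a <- s) ('X - a%:P))
  (f_not_power : forall d : nat, (1 < d)%N -> (d %| m)%N -> ~ exists g : E, tf f = g ^+ d)
  (yE : y ^+ m = (tf f)%:A) (F_gen : <<1; y>>%VS = {:F}%VS).
Variables (r : nat) (P : 'I_r -> set E).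
Hypotheses (P_inj : injective P)
  (P_range : range P = [set A | place (rat_cst tf) A /\ nu A (tf f) <> 0]).
Variables (n : nat) (n_le_r : (n <= r)%N).
Hypothesis P_ram : forall k : 'I_n, totally_ramified (rat_cst tf) F (P (widen_ord n_le_r k)).
Variable Q : 'I_n -> set F.
Hypotheses (Q_place : forall k : 'I_n, place (const_ext (rat_cst tf) F) (Q k))
  (Q_over : forall k : 'I_n, lies_over (Q k) (P (widen_ord n_le_r k)))
  (n_ge2 : (2 <= n)%N) (n_le_q : (n <= #|K|)%N).
Notation cF := (const_ext (rat_cst tf) F).

Let lambda := fun k : 'I_r => nu (P k) (tf f).
Let t := fun (k : 'I_n) (i : nat) => residue m (lambda (widen_ord n_le_r k)) i.

Lemma superelliptic_semigroup : exists N : nat -> int,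
  [/\ N 0%N = 0, forall i, (0 < i < m)%N -> N i = beta m lambda i + 1 - n%:Z,
      forall u i i' (x x' : int), (i < m)%N -> (i' < m)%N ->
        m%:Z * x + t u i = m%:Z * x' + t u i' -> i = i',
      forall i j a, of_class m t i j a -> N i <= \sum_u j u -> Hhat cF Q a
    & forall (a : {ffun 'I_n -> int}) (u : 'I_n), Hhat cF Q a -> exists i j d,
        [/\ of_class m t i j d, N i <= \sum_u j u, forall l, d l <= a l & d u = a u]].
Proof.
have m0 : (0 < m)%N := ltnW m_gt1; have n0 : (0 < n)%N := ltnW n_ge2.
have PB k : exists c, P k = rat_place tf c.
  have : range P (P k) by exists k.
  rewrite P_range => -[Pk nuk].
  apply: (rational_of_nu _ Pk nuk) => O; exact: (split_poly_units tf_inj tf_frac fs).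
have [B BE] := choice PB.
have B_inj : injective B by move=> k k' BB; apply: P_inj; rewrite !BE BB.
pose b u := B (widen_ord n_le_r u).
have b_inj : injective b.
  by move=> u u' /B_inj /(congr1 val) /= uu; apply: val_inj.
have PbE u : P (widen_ord n_le_r u) = rat_place tf (b u) by rewrite BE.
have Q_ram u : ramification_index (Q u) (rat_place tf (b u)) (\dim {:F}).
  rewrite -PbE; have [P' [_ _ uniq ram]] := P_ram u.
  by rewrite (uniq _ (Q_place u) (@Q_over u)).
have Q_uniq u Q' : place cF Q' -> lies_over Q' (rat_place tf (b u)) -> Q' = Q u.
  rewrite -PbE => Q'p Q'o; have [P' [_ _ uniq ram]] := P_ram u.
  by rewrite (uniq _ (Q_place u) (@Q_over u)); apply: uniq.
have tE u i : t u i = class_residue tf m f b u i by rewrite /t /lambda /residue PbE.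
(* [P] lists all zeros and poles of [f], so the sum in [beta] may be extended to all rational
   places. *)
have ordC c : c \notin codom B -> order_at tf f c = 0.
  move=> cB; apply: contrapT => nuc; move/negP: cB; apply.
  have : range P (rat_place tf c) by rewrite P_range; split=> //; apply: rat_place_place.
  move=> [k _]; rewrite BE => /(rat_place_inj tf_inj tf_frac) <-; exact: codom_f.
have cop := coprime_order_at tf_inj tf_frac m_gt1 mK f0 fs f_not_power yE F_gen Q_place Q_ram.
exists (class_bound tf m f b); split.
- rewrite /class_bound !big1 ?addr0 // => c _; rewrite /ceil_order mul0r ?oppr0 div0z ?oppr0 //.
- move=> i /andP[i0 im].
  have -> : beta m lambda i = \sum_c ceil_order tf m f i c - 1.
    rewrite (sum_codom B_inj) [X in _ + X - 1]big1 ?addr0 => [|c /ordC o0]; last first.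
      by rewrite /ceil_order o0 mulr0 oppr0 div0z oppr0.
    congr (_ - 1); apply: eq_bigr => k _.
    by rewrite ceil_ratE // /lambda BE.
  rewrite subrK (sum_codom b_inj) /class_bound addrAC; congr (_ + _).
  have -> : n%:Z = \sum_(u < n) 1 by rewrite sumr_const card_ord -[RHS]/(n%:R) natz.
  rewrite -sumrB.
  (* By coprimality [m] does not divide [x] when [0 < i < m], so ceiling and floor differ by 1 at
     each of the [n] places. *)
  apply: eq_bigr => u _; rewrite /ceil_order; set x := i%:Z * _.
  have xm : (x %% m)%Z != 0.
    apply/eqP => x0; have : (m%:Z %| i%:Z * order_at tf f (b u) - 0%N%:Z * order_at tf f (b u))%Z.
      by rewrite mul0r subr0; apply/dvdz_mod0P.
    by move/(coprime_mul_inj (cop u) im m0) => ie; rewrite ie in i0.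
  have mz : (m%:Z != 0) by rewrite eqz_nat -lt0n.
  have x_lt : (x %% m)%Z < m by apply: ltz_pmod; rewrite ltz_nat.
  have small : ((m%:Z - (x %% m)%Z) %/ m)%Z = 0.
    by apply: divz_small; move: xm x_lt (modz_ge0 x mz); move: (x %% m)%Z => z; clear; lia.
  have -> : - x = - ((x %/ m)%Z + 1) * m%:Z + (m%:Z - (x %% m)%Z).
    by rewrite {1}(divz_eq x m); ring.
  by rewrite divzMDl // small addr0 opprK addrK.
- move=> u i i' x x'; rewrite !tE.
  exact: (class_residue_inj tf_inj tf_frac m_gt1 mK f0 fs f_not_power yE F_gen Q_place Q_ram).
- move=> i j a [im aE]; apply: (monomial_Hhat tf_inj tf_frac m_gt1 mK f0 fs f_not_power yE F_gen
    b_inj n0 n_le_q Q_place Q_ram Q_uniq).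
  by split=> // u; rewrite aE tE.
- move=> a u Ha.
  have [i [j [d [[im dE] Nj da dau]]]] := Hhat_component tf_inj tf_frac m_gt1 mK f0 fs
    f_not_power yE F_gen b_inj n0 n_le_q Q_place Q_ram u Ha.
  by exists i, j, d; split=> //; split=> // l; rewrite dE tE.
Qed.

Theorem superelliptic_maximal (Upsilon : set {ffun 'I_n -> int}) (rho : nat)
  (Upsilon_rho : (Upsilon = Gamma cF Q /\ rho = 0%N) \/
     (Upsilon = Lambda cF Q /\ rho = (n - 2)%N)) :
  Upsilon =
    [set a | exists (i : nat) (j : {ffun 'I_n -> nat}),
       [/\ (1 <= i <= m - 1)%N,
           (\sum_(k < n) j k)%N%:Z = beta m lambda i + 1 - n%:Z + rho%:Z
         & a = [ffun k : 'I_n => m%:Z * (j k)%:Z + t k i]]]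
  /\ (Upsilon #=
       `I_(\sum_(1 <= i < m) binomz (beta m lambda i + rho%:Z) (n - 1)))%card.
Proof.
have m0 : (0 < m)%N := ltnW m_gt1; have n0 : (0 < n)%N := ltnW n_ge2.
have mz : m%:Z != 0 by rewrite eqz_nat -lt0n.
have [N [N0 NE tU H1 H2]] := superelliptic_semigroup.
have t_ge0 u i : 0 <= t u i by apply: modz_ge0.
have t_lt u i : t u i < m%:Z by apply: ltz_pmod; rewrite ltz_nat.
have t0 u : t u 0 = 0 by rewrite /t /residue mul0r mod0z.
have t_gt0 u i : (0 < i < m)%N -> 0 < t u i.
  move=> /andP[i0 im]; rewrite lt_neqAle t_ge0 andbT; apply/eqP => ti.
  by have := tU u i 0%N 0 0 im m0; rewrite t0 -ti => /(_ erefl) ie; rewrite ie in i0.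
(* Both cases are now treated alike: only the level [N i + rho] of the sum differs. *)
have [hat [-> hatc hatE rho_le]] : exists hat, [/\ Upsilon = hat `&` @positive_orthant n,
    forall a, hat a -> exists i j, of_class m t i j a,
    forall i j a, of_class m t i j a -> hat a <-> \sum_u j u = N i + rho%:Z
    & (rho < n)%N].
  case: Upsilon_rho => [[-> ->]|[-> ->]].
    exists (Gamma_hat cF Q); split=> //; first exact: (Gamma_hat_has_class n_ge2 H1 H2).
    by move=> i j a ca; rewrite addr0; apply: (Gamma_hat_class n_ge2 m0 tU H1 H2 ca).
  exists (Lambda_hat cF Q); split=> //; last by lia.
    exact: (Lambda_hat_has_class n_ge2 m0 tU H1 H2).
  by move=> i j a ca; apply: (Lambda_hat_class n_ge2 m0 tU H1 H2 ca).
set S := [set a | _].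
have SE : hat `&` @positive_orthant n = S.
  apply/seteqP; split=> a.
    move=> [hata apos]; have [i [j ca]] := hatc _ hata.
    have sj := iffLR (hatE _ _ _ ca) hata; have [im aE] := ca.
    have j_ge0 u : 0 <= j u.
      by have := apos u; rewrite aE; have := t_lt u i; have := m0; nia.
    (* In class 0 the residues vanish, so positive coordinates force each [j u >= 1] and a sum of at
       least [n], whereas the sum is [rho < n]. *)
    have i0 : (0 < i)%N.
      rewrite lt0n; apply/eqP => i0; rewrite i0 N0 add0r in sj.
      have : \sum_(u : 'I_n) 1 <= \sum_u j u.
        by apply: ler_sum => u _; have := apos u; rewrite aE i0 t0; have := m0; nia.
      rewrite sj sumr_const card_ord -[_ *+ _]/(n%:R) natz lez_nat.
      by rewrite leqNgt rho_le.
    exists i, [ffun u => absz (j u)]; split; first by lia.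
      rewrite (big_morph Posz PoszD erefl) -NE ?i0 // -sj.
      by apply: eq_bigr => u _; rewrite ffunE gez0_abs.
    by apply/ffunP => u; rewrite !ffunE gez0_abs.
  move=> [i [j [/andP[i0 im] sj ->]]].
  have {}im : (i < m)%N by lia.
  split.
    apply/(hatE i (fun u => (j u)%:Z)); first by split=> // u; rewrite ffunE.
    by rewrite NE ?i0 // -sj (big_morph Posz PoszD erefl).
  move=> u; rewrite ffunE; have := t_gt0 u i; rewrite i0 im => /(_ isT).
  by have : 0 <= m%:Z * (j u)%:Z by []; lia.
split=> //; rewrite SE.
(* The upper index [beta + rho] is the prescribed sum of the [j] plus [n - 1], as in the count of
   compositions into [n] parts. *)
rewrite (eq_bigr (fun i => binomz (beta m lambda i + 1 - n%:Z + rho%:Z + (n - 1)%N%:Z) (n - 1))).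
  apply: (card_compositions_pos (fun i => beta m lambda i + 1 - n%:Z + rho%:Z)
    (h := fun i j => [ffun k : 'I_n => m%:Z * (j k)%:Z + t k i])) => //.
  move=> i i' j j' im i'm /ffunP jj.
  have ii' : i = i'.
    by have := jj (Ordinal n0); rewrite !ffunE => /(tU _ _ _ _ _ im i'm).
  split=> //; apply/ffunP => u; have := jj u; rewrite !ffunE ii' => /addIr /(mulfI mz).
  by case.
by move=> i _; congr (binomz _ _); lia.
Qed.

End Superelliptic.

Theorem corollary3p5
  (K : finFieldType) (m : nat) (f : {poly K})
  (m_ge2 : (2 <= m)%N)
  (m_char : forall p : nat, p \in [pchar K] -> ~~ (p %| m)%N)
  (deg_f : (2 <= (size f).-1)%N)
  (roots_f : exists s : seq K, f %= \prod_(a <- s) ('X - a%:P))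
  (f_not_power : forall d : nat, (1 < d)%N -> (d %| m)%N ->
     ~ exists g : {fraction {poly K}}, tofrac f = g ^+ d)
  (F : fieldExtType {fraction {poly K}}) (y : F)
  (y_eq : y ^+ m = (tofrac f)%:A)
  (F_gen : <<1; y>>%VS = {:F}%VS)
  (r : nat) (P : 'I_r -> set {fraction {poly K}})
  (P_inj : injective P)
  (P_range : range P =
     [set A | place (ratfun_const K) A /\ nu A (tofrac f) <> 0])
  (n : nat) (n_le_r : (n <= r)%N)
  (P_ram : forall k : 'I_n,
     totally_ramified (ratfun_const K) F (P (widen_ord n_le_r k)))
  (Q : 'I_n -> set F)
  (Q_place : forall k : 'I_n, place (const_ext (ratfun_const K) F) (Q k))
  (Q_over : forall k : 'I_n, lies_over (Q k) (P (widen_ord n_le_r k)))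
  (n_ge2 : (2 <= n)%N) (n_le_q : (n <= #|K|)%N)
  (Upsilon : set {ffun 'I_n -> int}) (rho : nat)
  (Upsilon_rho :
     (Upsilon = Gamma (const_ext (ratfun_const K) F) Q /\ rho = 0%N) \/
     (Upsilon = Lambda (const_ext (ratfun_const K) F) Q /\ rho = (n - 2)%N)) :
  let lambda := fun k : 'I_r => nu (P k) (tofrac f) in
  let t := fun (k : 'I_n) (i : nat) =>
    residue m (lambda (widen_ord n_le_r k)) i in
  Upsilon =
    [set a | exists (i : nat) (j : {ffun 'I_n -> nat}),
       [/\ (1 <= i <= m - 1)%N,
           (\sum_(k < n) j k)%N%:Z = beta m lambda i + 1 - n%:Z + rho%:Z
         & a = [ffun k : 'I_n => m%:Z * (j k)%:Z + t k i]]]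
  /\ (Upsilon #=
       `I_(\sum_(1 <= i < m) binomz (beta m lambda i + rho%:Z) (n - 1)))%card.
Proof.
have f0 : f != 0.
  by apply: contraTneq deg_f => ->; rewrite size_poly0.
have m0 : (0 < m)%N := ltnW m_ge2.
have mK : m%:R != 0 :> K.
  apply/negP => mK0; have [p pK] := natf0_pchar m0 mK0.
  by move/negP: (m_char _ pK); apply; rewrite (dvdn_pcharf pK).
have [s fs] := roots_f.
have tf_inj : injective (@tofrac {poly K}).
  by move=> p q /eqP; rewrite tofrac_eq => /eqP.
exact: (@superelliptic_maximal K _ (@tofrac {poly K} : {rmorphism {poly K} -> {fraction {poly K}}})
  tf_inj (@frac_numden K) F m f s y m_ge2 mK f0 fs f_not_power y_eq F_gen r P P_inj P_range
  n n_le_r P_ram Q Q_place Q_over n_ge2 n_le_q Upsilon rho Upsilon_rho).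
Qed.
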